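(* Let $n\ge1$, $0<p<1$, $0<\tau_0\le\infty$, $\sigma\in J_n^+$, let $\Lambda$ be a continuous positive function, and let $V\ge0$ be continuous with $$V(x,t)\ge \Lambda(t)|x|^\sigma\qquad(|x|\ge1,\ 0<t<\tau_0).$$ Let $0\le u_0\in C(\mathbb{R}^n)$ with $u_0\not\equiv0$. Let $\varepsilon_0>0$ be any constant such that $$\int_{\{y:\,|x-y|\ge1\}}B(y)\,|x-y|^{\sigma+d}\,dy\ \ge\ \varepsilon_0|x|^{\sigma+d}\quad\text{for all }x\in\mathbb{R}^n\text{ and all }d\in\Big[0,\tfrac{\sigma p}{1-p}\Big].$$ If $u\ge0$ is an s-supersolution of $\partial_t u-\Delta\partial_t u=\Delta u+Vu^p$, $u(\cdot,0)=u_0$, on $Q_{\tau_0}$, then $$u(x,t)\ge\Big(\varepsilon_0(1-p)|x|^\sigma\int_0^t\Lambda(\tau)\,d\tau\Big)^{\frac{1}{1-p}}\qquad\text{on }Q_{\tau_0}.$$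
   Context: $J_n^+=\{0\}\cup[1,\infty)$ if $n=1$ and $J_n^+=[0,\infty)$ if $n\ge2$. $B=\mathcal{F}^{-1}((1+|\xi|^2)^{-1})$ is the Bessel kernel and $\mathcal{B}\varphi=B*\varphi=(I-\Delta)^{-1}\varphi$. For $a\in\mathbb{R}$, $BC_a$ is the space of continuous $\varphi$ on $\mathbb{R}^n$ with $|\varphi(x)|\le C|x|^a$ for $|x|$ large, normed by $\|\varphi\|_{R,a}=\sup_x(R^2+|x|^2)^{-a/2}|\varphi(x)|$; $\mathcal{Z}_{T,a}=C([0,T);BC_a)$, $Q_T=\mathbb{R}^n\times[0,T)$. A function $u\ge0$ is an s-supersolution on $Q_T$ if $\mu=e^tu\in\mathcal{Z}_{T,a}$ for some $a\in\mathbb{R}$ and $\mu(t)\ge u_0+\int_0^t\mathcal{B}\mu(\tau)\,d\tau+\int_0^te^{(1-p)\tau}\mathcal{B}[V\mu^p](\tau)\,d\tau$ on $Q_T$. (Constants $\varepsilon_0$ as in the claim exist.) *)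

(* Defs.v *)
From mathcomp Require Import all_boot all_order all_algebra.
From mathcomp Require Import all_classical all_reals all_analysis.
Set Implicit Arguments.
Unset Strict Implicit.
Unset Printing Implicit Defensive.
Import Order.TTheory GRing.Theory Num.Theory.
Import numFieldNormedType.Exports.
Local Open Scope classical_set_scope.
Local Open Scope ring_scope.

Section Defs.
Variable R : realType.

Definition enorm n (x : 'rV[R]_n) : R := Num.sqrt (\sum_(i < n) x ord0 i ^+ 2).

Definition rVcons n (a : R) (y : 'rV[R]_n) : 'rV[R]_n.+1 :=
  \row_(i < n.+1) match unlift ord0 i with Some j => y ord0 j | None => a end.

(* Lebesgue integral over R^n of a (nonnegative) function, as the iterated
   one-dimensional Lebesgue integral (equal to the n-dimensional one by Tonelli). *)
Fixpoint intRn (n : nat) : ('rV[R]_n -> \bar R) -> \bar R :=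
  match n with
  | 0 => fun f => f 0
  | n'.+1 => fun f =>
      (\int[lebesgue_measure]_(a in [set: R]) intRn (fun y : 'rV[R]_n' => f (rVcons a y)))%E
  end.

(* Bessel kernel B = F^{-1}((1+|xi|^2)^{-1}), i.e. the kernel of (I - Delta)^{-1},
   B(x) = \int_0^oo (4 pi s)^{-n/2} exp(-s - |x|^2/(4s)) ds  (value +oo allowed at 0). *)
Definition bessel n (x : 'rV[R]_n) : \bar R :=
  (\int[lebesgue_measure]_(s in [set s : R | (0 < s)%R])
     ((4 * pi * s) `^ (- (n%:R / 2)) * expR (- s - enorm x ^+ 2 / (4 * s)))%R%:E)%E.

Definition besselOp n (phi : 'rV[R]_n -> R) (x : 'rV[R]_n) : \bar R :=
  intRn (fun y => bessel (x - y) * (phi y)%:E)%E.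

Definition Jplus (n : nat) (sigma : R) : Prop :=
  if n == 1%N then sigma = 0 \/ 1 <= sigma else 0 <= sigma.

Definition BC n (a : R) (phi : 'rV[R]_n -> R) : Prop :=
  continuous phi /\
  exists C R0 : R, forall x, R0 <= enorm x -> `|phi x| <= C * enorm x `^ a.

Definition inI (T : \bar R) (t : R) : Prop := 0 <= t /\ (t%:E < T)%E.

(* Z_{T,a} = C([0,T); BC_a), with the norm ||.||_{1,a} (all R>0 give equivalent norms) *)
Definition Zspace n (T : \bar R) (a : R) (mu : 'rV[R]_n -> R -> R) : Prop :=
  (forall t, inI T t -> BC a (fun x => mu x t)) /\
  (forall t0, inI T t0 -> forall e : R, 0 < e -> exists2 d : R, 0 < d &
     forall t, inI T t -> `|t - t0| < d ->
       forall x, (1 + enorm x ^+ 2) `^ (- a / 2) * `|mu x t - mu x t0| <= e).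

Definition s_supersolution n (p : R) (V : 'rV[R]_n -> R -> R)
    (u0 : 'rV[R]_n -> R) (T : \bar R) (u : 'rV[R]_n -> R -> R) : Prop :=
  let mu := fun x t => expR t * u x t in
  (forall x t, inI T t -> 0 <= u x t) /\
  (exists a : R, Zspace T a mu) /\
  (forall x t, inI T t ->
     ((u0 x)%:E
      + \int[lebesgue_measure]_(tau in `[0%R, t]%classic) besselOp (fun y => mu y tau) x
      + \int[lebesgue_measure]_(tau in `[0%R, t]%classic)
          ((expR ((1 - p) * tau))%R%:E * besselOp (fun y => (V y tau * mu y tau `^ p)%R) x)
      <= (mu x t)%:E)%E).

End Defs.

(* Main.v *)
From HB Require Import structures.
Require Import Defs.
From mathcomp Require Import all_boot all_order all_algebra.
From mathcomp Require Import all_classical all_reals all_analysis.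
From mathcomp Require Import measurable_realfun.
From mathcomp Require Import ring lra.
Import Order.TTheory GRing.Theory Num.Theory.
Import numFieldNormedType.Exports.
Local Open Scope classical_set_scope.
Local Open Scope ring_scope.

(** The function [mu = e^t u] satisfies
    [mu >= \int_0^t B mu + \int_0^t e^((1-p)tau) B(V mu^p)], and every lower
    bound for [mu] can be fed back into the right-hand side.  Write
    [a = 1/(1-p)] and [Theta(t) = \int_s^t Lambda] for a small [s > 0].

    Sublinearity makes this iteration contract logarithmically: a bound
    [mu >= A w Theta^a] becomes [mu >= k(1-p) A^p w' Theta^a] as soon as
    [B(1_(|y|>=1) |y|^sigma w^p) >= k w'], so the constants tend to
    [(k(1-p))^a] whatever the initial [A > 0] is.  Starting from the Gaussian
    lower bound given by [u_0 <> 0] the weights [exp(-lambda_i |x|^2)] with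
    [lambda_i -> 0] lead to [mu >= c Theta^a]; restarting from there with the
    weights [|x|^(d_i)], where [d_i = sigma (1-p^i)/(1-p)], and [k = eps0] gives
    the claimed constant.  In the second round the linear term [B mu] supplies the
    factor [e^t]; this uses [B |x|^d >= |x|^d], and is where [J_n^+] enters.

    Integrals of nonnegative functions are suprema over simple functions, hence
    monotone without any measurability assumption, so the measurability of [B mu]
    in time and space is never needed.

    The inequality [B |x|^d >= |x|^d] is proved for the heat kernel and
    integrated in time.  For [n = 1] and [d >= 1] it is midpoint convexity.  For
    [n >= 2] put [N(r) = \int_0^M e^(-r/v) dv/v].  Since [e^(-|y|^2/v)/v] is a
    two-dimensional heat kernel, the heat semigroup at time [s] increases
    [N(|x|^2)] by at most [4s/M], whereas [N(r) + log r] is nondecreasing with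
    slope at most [1/M]; so [|x|^d] inherits its sub-mean value property from that
    of [log |x|] as [M -> oo]. *)

(** * Integrals of arbitrary nonnegative functions *)

Section LowerIntegral.
Context {d : measure_display} {T : measurableType d} {R : realType}.
Variable mu : {measure set T -> \bar R}.
Local Open Scope ereal_scope.
Import HBNNSimple.

(** A simple function below [f] on [A], extended by zero, also lies below [g] on [B], so the
    supremum defining the second integral runs over a larger family. *)
Lemma le_lower_integral (A B : set T) (f g : T -> \bar R) :
  (forall x, A x -> 0 <= f x) -> (forall x, B x -> 0 <= g x) ->
  A `<=` B -> (forall x, A x -> f x <= g x) ->
  \int[mu]_(x in A) f x <= \int[mu]_(x in B) g x.
Proof.
move=> f0 g0 AB fg; rewrite !ge0_integralE//.
apply: le_ereal_sup => _ [h /= hf <-]; exists h => // x.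
apply: (le_trans (hf x)); rewrite /patch.
case: ifPn => [/set_mem Ax|_]; first by rewrite (mem_set (AB _ Ax)) fg.
by case: ifPn => // /set_mem /g0.
Qed.

(** Scaling by [c] sends simple functions below [f] to simple functions below [c f]. The reverse
    inequality comes from the same fact for [c^-1], which is how [intRnZ] obtains equality. *)
Lemma lower_integralZ_le (c : R) (f : T -> \bar R) : (0 <= c)%R ->
  (forall x, 0 <= f x) ->
  c%:E * \int[mu]_x f x <= \int[mu]_x (c%:E * f x).
Proof.
move=> c0 f0; have [->|cn0] := eqVneq c 0%R.
  by rewrite mul0e; apply: integral_ge0 => x _; rewrite mul0e.
have cp : (0 < c)%R by rewrite lt0r cn0.
rewrite !ge0_integralTE//; last by move=> x; rewrite mule_ge0.
rewrite muleC -lee_pdivlMr//; apply: ge_ereal_sup => _ [h /= hf <-].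
rewrite lee_pdivlMr// muleC -sintegralrM.
apply: ereal_sup_ubound; exists (scale_nnsfun h c0) => // x.
by rewrite /= EFinM lee_wpmul2l ?lee_fin.
Qed.

Lemma lower_integralZ_in_le (D : set T) (c : R) (f : T -> \bar R) : (0 <= c)%R ->
  (forall x, D x -> 0 <= f x) ->
  c%:E * \int[mu]_(x in D) f x <= \int[mu]_(x in D) (c%:E * f x).
Proof.
move=> c0 f0; rewrite integral_mkcond [leRHS]integral_mkcond.
have -> : (fun x => c%:E * f x) \_ D = fun x => c%:E * (f \_ D) x.
  by apply/funext => x; rewrite /patch; case: ifP => // _; rewrite mule0.
by apply: lower_integralZ_le => // x; rewrite /patch; case: ifPn => // /set_mem /f0.
Qed.

End LowerIntegral.

(** * Invariance of Lebesgue measure under reflections *)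

Section Reflection.
Context {R : realType}.
Local Open Scope ereal_scope.
Local Notation mu := (@lebesgue_measure R).
Import HBNNSimple.

Lemma lebesgue_measure_reflect (b : R) (A : set R) : measurable A ->
  pushforward mu ((fun a => b - a)%R : _ -> measurableTypeR R) A = mu A.
Proof.
move=> mA.
pose g : measurableTypeR R -> measurableTypeR R := fun a => (b - a)%R.
have mb : measurable_fun setT g by apply: measurable_funB.
pose mix := isMeasurableFun.Build _ _ _ _ g mb.
pose phi : {mfun measurableTypeR R >-> measurableTypeR R} := HB.pack g mix.
apply/esym/(@lebesgue_measure_unique _ (pushforward mu phi)) => //= _ [[u v]] _ <-.
rewrite /pushforward.
have -> : (fun a => b - a)%R @^-1` `]u, v] = `[(b - v)%R, (b - u)%R[%classic.
  apply/seteqP; split => x /=; rewrite !in_itv/= => /andP[h1 h2];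
    by apply/andP; split; lra.
rewrite !lebesgue_measure_itv/= !lte_fin ltrD2l ltrN2.
by case: ifP => // _; rewrite -!EFinB; congr EFin; ring.
Qed.

(** Change of variables is applied only to the simple functions [h] in the supremum: [h (b - x)]
    lies below [f x] and has the same integral as [h]. *)
Lemma integral_reflect_le (b : R) (f : R -> \bar R) : (forall x, 0 <= f x) ->
  \int[mu]_x f (b - x)%R <= \int[mu]_x f x.
Proof.
move=> f0; rewrite !ge0_integralTE//.
apply: ge_ereal_sup => _ [h /= hf <-].
pose g : measurableTypeR R -> measurableTypeR R := fun a => (b - a)%R.
have mb : measurable_fun setT g by apply: measurable_funB.
rewrite -integralT_nnsfun -ge0_integralTE//.
have -> : \int[mu]_x (h x)%:E = \int[mu]_x (h (b - x)%R)%:E.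
  rewrite -[RHS](@ge0_integral_pushforward _ _ _ _ _ _ mb mu setT (EFin \o h)) //.
    by apply: eq_measure_integral => A mA _; exact/esym/lebesgue_measure_reflect.
    exact/measurable_EFinP.
  by move=> y _; rewrite lee_fin.
apply: le_lower_integral => // x _; first by rewrite lee_fin.
by rewrite (le_trans (hf _))// opprB addrCA subrr addr0.
Qed.
End Reflection.

(** * Monotonicity, scaling and reflection for iterated integrals *)

Section IteratedIntegral.
Context {R : realType}.
Implicit Types n : nat.
Local Notation mu := (@lebesgue_measure R).

Definition rVtail {n} (x : 'rV[R]_n.+1) : 'rV[R]_n := \row_j x ord0 (lift ord0 j).

Lemma rVcons0 {n} a (y : 'rV[R]_n) : rVcons a y ord0 ord0 = a.
Proof. by rewrite mxE unlift_none. Qed.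

Lemma rVconsS {n} a (y : 'rV[R]_n) j : rVcons a y ord0 (lift ord0 j) = y ord0 j.
Proof. by rewrite mxE liftK. Qed.

Lemma subr_rVcons {n} (x : 'rV[R]_n.+1) a y :
  x - rVcons a y = rVcons (x ord0 ord0 - a) (rVtail x - y).
Proof.
apply/rowP => i; rewrite [LHS]mxE [X in _ + X]mxE.
have [j ->|->] := unliftP ord0 i; last by rewrite !rVcons0.
by rewrite !rVconsS !mxE.
Qed.

Local Open Scope ereal_scope.

Lemma intRn_ge0 {n} (f : 'rV[R]_n -> \bar R) : (forall y, 0 <= f y) -> 0 <= intRn f.
Proof.
elim: n f => [|n IH] f f0 //=.
by apply: integral_ge0 => a _; apply: IH.
Qed.

Lemma le_intRn {n} (f g : 'rV[R]_n -> \bar R) : (forall y, 0 <= f y) ->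
  (forall y, f y <= g y) -> intRn f <= intRn g.
Proof.
elim: n f g => [|n IH] f g f0 fg //=.
have g0 y : 0 <= g y by exact: le_trans (f0 y) (fg y).
by apply: le_lower_integral => // a _; [apply: intRn_ge0|apply: intRn_ge0|apply: IH].
Qed.

Lemma intRnZ_le {n} (c : R) (f : 'rV[R]_n -> \bar R) : (0 <= c)%R ->
  (forall y, 0 <= f y) -> c%:E * intRn f <= intRn (fun y => c%:E * f y).
Proof.
move=> c0; elim: n f => [|n IH] f f0 //=.
apply: le_trans (lower_integralZ_le _ _ _ c0 _) _; first by move=> a; apply: intRn_ge0.
apply: le_lower_integral => // a _; last exact: IH.
  by rewrite mule_ge0 ?intRn_ge0.
by apply: intRn_ge0 => y; rewrite mule_ge0.
Qed.

Lemma intRn0 n : intRn (fun _ : 'rV[R]_n => 0 : \bar R) = 0.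
Proof. by elim: n => [|n IH] //=; apply: integral0_eq => a _; rewrite IH. Qed.

Lemma intRnZ {n} (c : R) (f : 'rV[R]_n -> \bar R) : (0 <= c)%R ->
  (forall y, 0 <= f y) -> intRn (fun y => c%:E * f y) = c%:E * intRn f.
Proof.
move=> c0 f0; have [->|cn0] := eqVneq c 0%R.
  by rewrite mul0e; under eq_fun do rewrite mul0e; rewrite intRn0.
have cp : (0 < c)%R by rewrite lt0r cn0.
apply/eqP; rewrite eq_le intRnZ_le// andbT.
rewrite muleC -lee_pdivrMr// muleC.
apply: (le_trans (intRnZ_le c^-1 _ _ _)).
- by rewrite invr_ge0.
- by move=> y; rewrite mule_ge0.
by under eq_fun do rewrite muleA -EFinM mulVf// mul1e.
Qed.

Lemma intRn_reflect_le {n} (x : 'rV[R]_n) (f : 'rV[R]_n -> \bar R) :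
  (forall y, 0 <= f y) -> intRn (fun y => f (x - y)%R) <= intRn f.
Proof.
elim: n x f => [|n IH] x f f0 /=.
  by rewrite [(x - 0)%R](_ : _ = 0%R)//; apply/rowP => -[].
apply: (@le_trans _ _
    (\int[mu]_a (fun b => intRn (fun y => f (rVcons b y))) (x ord0 ord0 - a)%R)).
  apply: le_lower_integral => // a _; [exact: intRn_ge0|exact: intRn_ge0|].
  under eq_fun do rewrite subr_rVcons.
  exact: (IH (rVtail x) (fun y => f (rVcons (x ord0 ord0 - a)%R y))).
by apply: integral_reflect_le => b; exact: intRn_ge0.
Qed.

(** The factor [(2 * r) ^+ n] is the volume of the cube centred at [b]; each coordinate contributes
    an interval of length [2 * r]. *)
Lemma intRn_box {n} (c r : R) (b : 'rV[R]_n) (f : 'rV[R]_n -> \bar R) :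
  (0 <= c)%R -> (0 <= r)%R -> (forall y, 0 <= f y) ->
  (forall y : 'rV[R]_n, (forall i, `|y ord0 i - b ord0 i| < r)%R -> c%:E <= f y) ->
  (c * (2 * r) ^+ n)%:E <= intRn f.
Proof.
move=> c0 r0; elim: n b f => [|n IH] b f f0 fc /=.
  by rewrite expr0 mulr1; apply: fc => -[].
pose B := ball (b ord0 ord0) r.
apply: (@le_trans _ _ (\int[mu]_(a in B) (c * (2 * r) ^+ n)%:E)).
  rewrite integral_cst; last exact: measurable_ball.
  rewrite [X in _ * X](lebesgue_measure_ball _ r0).
  by rewrite -EFinM lee_fin exprS -mulr_natl; lra.
apply: le_lower_integral => //.
- by move=> a _; rewrite lee_fin mulr_ge0// exprn_ge0// mulr_ge0.
- by move=> a _; exact: intRn_ge0.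
move=> a; rewrite /B /ball/= => aB; apply: (IH (rVtail b)) => // y yb; apply: fc => i.
have [j ->|->] := unliftP ord0 i; last by rewrite rVcons0 distrC.
by rewrite rVconsS; have := yb j; rewrite mxE.
Qed.

End IteratedIntegral.

(** * Measurable families and iterated integrals *)

Section MeasurableFamily.
Context {R : realType}.
Local Notation mu := (@lebesgue_measure R).
Local Notation mR := (measurableTypeR R).

(* Joint measurability of [f t y] in [t] and the coordinates of [y], which are
   adjoined to the parameter space one at a time. *)
Fixpoint mfam n : forall d (T : measurableType d), (T -> 'rV[R]_n -> \bar R) -> Prop :=
  match n with
  | 0 => fun d T f => measurable_fun setT (fun t => f t 0)
  | n'.+1 => fun d T f =>
      @mfam n' _ (T * mR)%type (fun (ta : T * mR) y => f ta.1 (rVcons ta.2 y))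
  end.
Arguments mfam {n d T}.

Lemma mfam_comp {n} d d' (T : measurableType d) (T' : measurableType d')
    (g : T' -> T) (f : T -> 'rV[R]_n -> \bar R) :
  measurable_fun setT g -> mfam f -> mfam (fun t' => f (g t')).
Proof.
elim: n d d' T T' g f => [|n IH] d d' T T' g f mg /=.
  by move=> mf; exact: (measurableT_comp mf mg).
move=> mf; apply: (IH _ _ _ _ (fun ta : T' * mR => (g ta.1, ta.2)) _ _ mf).
apply: measurable_fun_pair; last exact: measurable_snd.
exact: (measurableT_comp mg measurable_fst).
Qed.

Lemma measurable_intRn {n} d (T : measurableType d) (f : T -> 'rV[R]_n -> \bar R) :
  (forall t y, (0 <= f t y)%E) -> mfam f ->
  measurable_fun setT (fun t => intRn (f t)).
Proof.
elim: n d T f => [|n IH] d T f f0 //= mf.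
have m1 := IH _ _ _ (fun (ta : T * mR) y => f0 ta.1 (rVcons ta.2 y)) mf.
apply: (measurable_fun_fubini_tonelli_F (m2 := mu) _ m1) => ta.
exact: intRn_ge0.
Qed.

Lemma measurable_intRn_section {n} d (T : measurableType d)
    (f : T -> 'rV[R]_n.+1 -> \bar R) t :
  (forall t y, (0 <= f t y)%E) -> mfam f ->
  measurable_fun [set: mR] (fun a => intRn (fun y => f t (rVcons a y))).
Proof.
move=> f0 mf.
have m1 := measurable_intRn _ _ _ (fun (ta : T * mR) y => f0 ta.1 (rVcons ta.2 y)) mf.
have mp : measurable_fun [set: mR] (fun a : mR => (t, a)).
  by apply: measurable_fun_pair.
exact: (measurableT_comp m1 mp).
Qed.

(** Additivity, unlike monotonicity, rests on measurability. The parameter [t] carries the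
    induction: it collects the coordinates whose integrals have already been opened. *)
Lemma intRnD {n} d (T : measurableType d) (f g : T -> 'rV[R]_n -> \bar R) t :
  (forall t y, (0 <= f t y)%E) -> (forall t y, (0 <= g t y)%E) ->
  mfam f -> mfam g ->
  intRn (fun y => (f t y + g t y)%E) = (intRn (f t) + intRn (g t))%E.
Proof.
elim: n d T f g t => [|n IH] d T f g t f0 g0 mf mg //=.
rewrite -ge0_integralD//; first last.
- exact: measurable_intRn_section.
- by move=> a _; exact: intRn_ge0.
- exact: measurable_intRn_section.
- by move=> a _; exact: intRn_ge0.
apply: eq_integral => a _.
exact: (IH _ _ (fun (ta : T * mR) y => f ta.1 (rVcons ta.2 y))
  (fun (ta : T * mR) y => g ta.1 (rVcons ta.2 y)) (t, a)).
Qed.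

Lemma intRn_tonelli {n} d (T : measurableType d)
    (m : {sigma_finite_measure set T -> \bar R}) (f : T -> 'rV[R]_n -> \bar R) :
  (forall t y, (0 <= f t y)%E) -> mfam f ->
  (\int[m]_t intRn (f t) = intRn (fun y => \int[m]_t f t y))%E.
Proof.
elim: n f => [|n IH] f f0 mf //=.
have m1 := measurable_intRn _ _ _ (fun (ta : T * mR) y => f0 ta.1 (rVcons ta.2 y)) mf.
rewrite (fubini_tonelli (m1 := m) (m2 := mu) _ m1); last first.
  by move=> ta; exact: intRn_ge0.
apply: eq_integral => a _ /=.
apply: (IH (fun t y => f t (rVcons a y))) => //.
apply: (mfam_comp _ _ _ _ (fun t => (t, a)) _ _ mf).
by apply: measurable_fun_pair.
Qed.

(** The constant [k] makes the induction go through: it absorbs the factor of the first coordinate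
    while the others are integrated. *)
Lemma intRn_prod {n} (k : R) (h : 'I_n -> R -> R) (c : 'I_n -> R) : 0 <= k ->
  (forall i a, 0 <= h i a) -> (forall i, measurable_fun [set: mR] (h i)) ->
  (forall i, (\int[mu]_a (h i a)%:E = (c i)%:E)%E) ->
  (intRn (fun y => (k * \prod_(i < n) h i (y ord0 i))%:E) =
    (k * \prod_(i < n) c i)%:E)%E.
Proof.
elim: n k h c => [|n IH] k h c k0 h0 mh hc /=; first by rewrite !big_ord0.
rewrite big_ord_recl mulrA.
under eq_integral => a _.
  under eq_fun do rewrite big_ord_recl rVcons0 mulrA.
  under eq_fun do under eq_bigr do rewrite rVconsS.
  rewrite (IH _ (fun i => h (lift ord0 i)) (fun i => c (lift ord0 i))) ?mulr_ge0//.
  rewrite mulrAC EFinM.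
  over.
have c0 i : 0 <= c i.
  by rewrite -lee_fin -hc; apply: integral_ge0 => a _; rewrite lee_fin.
rewrite ge0_integralZl//.
- by rewrite hc -EFinM mulrAC.
- exact/measurable_EFinP.
- by move=> a _; rewrite lee_fin.
- by rewrite lee_fin mulr_ge0// prodr_ge0.
Qed.

Lemma enorm_sqr n (x : 'rV[R]_n) : enorm x ^+ 2 = \sum_(i < n) x ord0 i ^+ 2.
Proof. by rewrite sqr_sqrtr// sumr_ge0// => i _; rewrite sqr_ge0. Qed.

Lemma enorm_ge0 n (x : 'rV[R]_n) : 0 <= enorm x.
Proof. exact: sqrtr_ge0. Qed.

Lemma enormN n (x : 'rV[R]_n) : enorm (- x) = enorm x.
Proof. by congr Num.sqrt; apply: eq_bigr => i _; rewrite mxE sqrrN. Qed.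

(** Peeling off one coordinate merely adds a square to each of the two real arguments of [Phi], so
    the induction runs over all [Phi]. Two centres occur because a heat kernel around [x] will be
    multiplied by a radial function around [z]. *)
Lemma mfam_sum_sqr {n} d (T : measurableType d) (Phi : T * (mR * mR) -> \bar R)
    (x z : 'rV[R]_n) : measurable_fun setT Phi ->
  mfam (fun t y => Phi (t, (\sum_(i < n) (x - y) ord0 i ^+ 2,
                            \sum_(i < n) (z - y) ord0 i ^+ 2))).
Proof.
elim: n d T Phi x z => [|n IH] d T Phi x z mPhi /=.
  apply: (measurableT_comp mPhi); apply: measurable_fun_pair => //.
pose Psi (w : (T * mR) * (mR * mR)) : \bar R :=
  Phi (w.1.1, ((x ord0 ord0 - w.1.2) ^+ 2 + w.2.1, (z ord0 ord0 - w.1.2) ^+ 2 + w.2.2)).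
have mPsi : measurable_fun setT Psi.
  apply: (measurableT_comp mPhi); apply: measurable_fun_pair.
    by apply: measurableT_comp => //; exact: measurable_fst.
  have m12 : measurable_fun [set: (T * mR) * (mR * mR)] (fun w => w.1.2 : mR).
    by apply: (measurableT_comp measurable_snd); exact: measurable_fst.
  apply: measurable_fun_pair; apply: measurable_funD.
  - by apply: measurable_funX; apply: measurable_funB.
  - by apply: (measurableT_comp measurable_fst); exact: measurable_snd.
  - by apply: measurable_funX; apply: measurable_funB.
  - by apply: (measurableT_comp measurable_snd); exact: measurable_snd.
have := IH _ _ Psi (rVtail x) (rVtail z) mPsi.
congr mfam; apply/funext => -[t a]; apply/funext => y; rewrite /Psi/=.
congr (Phi (_, (_, _))); rewrite subr_rVcons [in RHS]big_ord_recl rVcons0;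
  by congr +%R; apply: eq_bigr => i _; rewrite rVconsS.
Qed.

Lemma mfam_enorm {n} d (T : measurableType d) (Phi : T * (mR * mR) -> \bar R)
    (x z : 'rV[R]_n) : measurable_fun setT Phi ->
  mfam (fun t y => Phi (t, (enorm (x - y), enorm (z - y)))).
Proof.
move=> mPhi.
pose Psi (w : T * (mR * mR)) := Phi (w.1, (Num.sqrt w.2.1, Num.sqrt w.2.2)).
apply: (mfam_sum_sqr _ _ Psi x z).
have msqrt : measurable_fun [set: mR] (@Num.sqrt R : mR -> mR).
  by apply: continuous_measurable_fun; exact: sqrt_continuous.
apply: (measurableT_comp mPhi); apply: measurable_fun_pair.
  exact: measurable_fst.
apply: measurable_fun_pair; apply: (measurableT_comp msqrt).
- by apply: (measurableT_comp measurable_fst); exact: measurable_snd.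
- by apply: (measurableT_comp measurable_snd); exact: measurable_snd.
Qed.

End MeasurableFamily.
Arguments mfam {R n d T}.

(** * Heat and Bessel kernels *)

Section Heat.
Context {R : realType}.
Local Notation mu := (@lebesgue_measure R).
Local Notation mR := (measurableTypeR R).

(** The integrand is [Num.sqrt (pi * tau)] times the normal density of mean [m] and variance
    [tau / 2]. *)
Lemma integral_gauss (m tau : R) : 0 < tau ->
  (\int[mu]_a (expR (- ((a - m) ^+ 2 / tau)))%:E = (Num.sqrt (pi * tau))%:E)%E.
Proof.
move=> t0; pose s := Num.sqrt (tau / 2).
have s2 : s ^+ 2 = tau / 2 by rewrite sqr_sqrtr// divr_ge0// ltW.
have sn0 : s != 0 by rewrite gt_eqF// sqrtr_gt0 divr_gt0.
have r0 : 0 < Num.sqrt (pi * tau) by rewrite sqrtr_gt0 mulr_gt0// pi_gt0.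
have E a : (expR (- ((a - m) ^+ 2 / tau)))%:E =
    ((Num.sqrt (pi * tau))%:E * (normal_pdf m s a)%:E)%E.
  rewrite normal_pdfE// /normal_peak /normal_fun s2 -EFinM.
  rewrite -[tau / 2 * pi *+ 2]mulr_natl -[tau / 2 *+ 2]mulr_natl.
  rewrite (_ : 2 * (tau / 2 * pi) = pi * tau); last by field.
  rewrite (_ : 2 * (tau / 2) = tau); last by field.
  by rewrite mulrA divff ?gt_eqF// mul1r mulNr.
under eq_integral do rewrite E.
rewrite ge0_integralZl//; first by rewrite integral_normal_pdf mule1.
- by apply/measurable_EFinP; exact: measurable_normal_pdf.
- by move=> a _; rewrite lee_fin normal_pdf_ge0.
Qed.

Definition heat {n} (s : R) (z : 'rV[R]_n) : R :=
  (4 * pi * s) `^ (- (n%:R / 2)) * expR (- (enorm z ^+ 2 / (4 * s))).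

Lemma heat_ge0 n s (z : 'rV[R]_n) : 0 <= heat s z.
Proof. by rewrite mulr_ge0 ?powR_ge0 ?expR_ge0. Qed.

(** Completing the square: with [w = 1 + 4 s b] the exponent equals
    [w (a - x / w)^2 / (4 s) + b x^2 / w]. *)
Lemma gauss_conv1 (s b x : R) : 0 < s -> 0 <= b ->
  (\int[mu]_a ((4 * pi * s) `^ (- (1 / 2)) *
      expR (- ((x - a) ^+ 2 / (4 * s) + b * a ^+ 2)))%:E =
  ((1 + 4 * s * b) `^ (- (1 / 2)) * expR (- (b * x ^+ 2 / (1 + 4 * s * b))))%:E)%E.
Proof.
move=> s0 b0; set w := 1 + 4 * s * b.
have w0 : 0 < w by rewrite ltr_pwDl// mulr_ge0// mulr_ge0// ltW.
have pi0 : 0 < pi :> R := pi_gt0 R.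
pose k := (4 * pi * s) `^ (- (1 / 2)) * expR (- (b * x ^+ 2 / w)).
have k0 : 0 <= k by rewrite mulr_ge0 ?powR_ge0 ?expR_ge0.
have E a : ((4 * pi * s) `^ (- (1 / 2)) *
      expR (- ((x - a) ^+ 2 / (4 * s) + b * a ^+ 2)))%:E =
    (k%:E * (expR (- ((a - x / w) ^+ 2 / (4 * s / w))))%:E)%E.
  rewrite -EFinM /k -(mulrA (_ `^ _)) -expRD; congr (_ * expR _)%:E.
  have wn0 : w != 0 by rewrite gt_eqF.
  have : w = 1 + 4 * s * b by [].
  have sn0 : s != 0 by rewrite gt_eqF.
  clearbody w => ew; have -> : b = (w - 1) / (4 * s) by rewrite ew; field.
  by field; rewrite wn0 sn0.
under eq_integral do rewrite E.
rewrite ge0_integralZl//; last first.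
  apply/measurable_EFinP; apply: measurableT_comp => //.
  apply: measurableT_comp => //; apply: measurable_funM => //.
  by apply: measurable_funX; apply: measurable_funB.
rewrite integral_gauss ?divr_gt0 ?mulr_gt0// -EFinM /k mulrAC; congr (_ * _)%:E.
rewrite !powRN !div1r !powR12_sqrt ?(ltW w0)//; last by rewrite !mulr_ge0// ltW.
rewrite (_ : pi * (4 * s / w) = (4 * pi * s) / w); last by field; rewrite gt_eqF.
have p0 : 0 < 4 * pi * s by rewrite !mulr_gt0.
rewrite [Num.sqrt (_ / w)]sqrtrM ?(ltW p0)// sqrtrV ?(ltW w0)// mulrA mulVf ?mul1r//.
by rewrite sqrtr_eq0 -ltNge.
Qed.

Lemma heat_gauss n (s b : R) (x : 'rV[R]_n) : 0 < s -> 0 <= b ->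
  intRn (fun y => (heat s (x - y) * expR (- (b * enorm y ^+ 2)))%:E) =
  (((1 + 4 * s * b) `^ (- (1 / 2))) ^+ n *
     expR (- (b * enorm x ^+ 2 / (1 + 4 * s * b))))%:E.
Proof.
move=> s0 b0; have pi0 : 0 < pi :> R := pi_gt0 R.
pose h (i : 'I_n) (a : R) := (4 * pi * s) `^ (- (1 / 2)) *
      expR (- ((x ord0 i - a) ^+ 2 / (4 * s) + b * a ^+ 2)).
have E y : (heat s (x - y) * expR (- (b * enorm y ^+ 2)))%:E =
    (1 * \prod_(i < n) h i (y ord0 i))%:E.
  rewrite /heat mul1r !enorm_sqr big_split/= prodr_const card_ord -(mulrA (_ `^ _)) -expRD.
  congr (_ * _)%:E.
    by rewrite -powR_mulrn ?powR_ge0// -powRrM; congr (_ `^ _); field.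
  rewrite -expR_sum sumrN big_split/= -opprD -mulr_suml -mulr_sumr.
  by under eq_bigr do rewrite !mxE.
under eq_fun do rewrite E.
rewrite (intRn_prod _ _ (fun i => (1 + 4 * s * b) `^ (- (1 / 2)) *
   expR (- (b * x ord0 i ^+ 2 / (1 + 4 * s * b)))))//.
- rewrite mul1r big_split/= prodr_const card_ord -expR_sum sumrN.
  by rewrite -mulr_suml -mulr_sumr enorm_sqr.
- by move=> i a; rewrite mulr_ge0 ?powR_ge0 ?expR_ge0.
- move=> i; apply: measurable_funM => //; apply: measurableT_comp => //.
  apply: measurableT_comp => //; apply: measurable_funD.
    apply: measurable_funM => //.
    by apply: measurable_funX; apply: measurable_funB.
  by apply: measurable_funM => //; apply: measurable_funX.
- by move=> i; exact: gauss_conv1.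
Qed.

Lemma intRn_heat n (s : R) (x : 'rV[R]_n) : 0 < s ->
  intRn (fun y => (heat s (x - y))%:E) = 1%E.
Proof.
move=> s0; have := heat_gauss n s 0 x s0 (lexx 0).
under eq_fun do rewrite mul0r oppr0 expR0 mulr1.
by move=> ->; rewrite !mulr0 addr0 powR1 expr1n !mul0r oppr0 expR0 mulr1.
Qed.

End Heat.

(** * The Bessel operator as an average of the heat semigroup *)

Section BesselHeat.
Context {R : realType}.
Local Notation mu := (@lebesgue_measure R).
Local Notation mR := (measurableTypeR R).

Lemma integral_expRN :
  (\int[mu]_(s in [set s : R | (0 < s)%R]) (expR (- s))%:E = 1)%E.
Proof.
have -> : [set s : R | (0 < s)%R] = `]0, +oo[%classic.
  by apply/seteqP; split => s /=; rewrite in_itv/= andbT.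
rewrite integral_itv_obnd_cbnd; last first.
  by apply/measurable_funTS/measurable_EFinP; do 2 apply: measurableT_comp => //.
rewrite -(@integral_exponential_pdf R 1)// integral_mkcond.
apply: eq_integral => s _; rewrite /exponential_pdf /patch.
by case: ifP => // _; rewrite mul1r mulN1r.
Qed.

(** The integrand of [bessel] as a function of time and radius, extended by zero to nonpositive
    times. The division is written as a power so that joint measurability follows from that of
    [powR]. *)
Definition bessel_density n (w : mR * mR) : \bar R :=
  if 0 < w.1 then ((4 * pi * w.1) `^ (- (n%:R / 2)) *
    expR (- w.1 - w.2 ^+ 2 * (4 * w.1) `^ (-1)))%:E else 0%E.

Lemma measurable_bessel_density n : measurable_fun setT (bessel_density n).
Proof.
have m1 : measurable_fun [set: mR * mR] (fun w : mR * mR => w.1 : R).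
  exact: measurable_fst.
have m2 : measurable_fun [set: mR * mR] (fun w : mR * mR => w.2 : R).
  exact: measurable_snd.
apply: measurable_fun_ifT => //; first exact: measurable_fun_ltr.
apply/measurable_EFinP; apply: measurable_funM.
  apply: (measurableT_comp (@measurable_powR R _)).
  exact: measurable_funM.
apply: (measurableT_comp (@measurable_expR R)); apply: measurable_funB.
  exact: (measurableT_comp _ m1).
apply: measurable_funM; first exact: measurable_funX.
apply: (measurableT_comp (@measurable_powR R _)).
exact: measurable_funM.
Qed.

Lemma bessel_density_ge0 n w : (0 <= bessel_density n w)%E.
Proof.
rewrite /bessel_density; case: ifP => // _.
by rewrite lee_fin mulr_ge0 ?powR_ge0 ?expR_ge0.
Qed.

Lemma bessel_densityE n s (z : 'rV[R]_n) : 0 < s ->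
  bessel_density n (s, enorm z) = (expR (- s) * heat s z)%:E.
Proof.
move=> s0; rewrite /bessel_density/= s0 /heat mulrCA -expRD.
by rewrite powR_inv1// mulr_ge0// ltW.
Qed.

Lemma besselE n (z : 'rV[R]_n) :
  bessel z = (\int[mu]_s bessel_density n (s, enorm z))%E.
Proof.
rewrite /bessel integral_mkcond; apply: eq_integral => s _.
rewrite /patch /bessel_density/=.
have [s0|s0] := boolP (0 < s); last by rewrite memNset//; exact/negP.
by rewrite mem_set// powR_inv1// mulr_ge0// ltW.
Qed.

Lemma bessel_ge0 n (z : 'rV[R]_n) : (0 <= bessel z)%E.
Proof. by rewrite besselE integral_ge0// => s _; exact: bessel_density_ge0. Qed.

(** By Tonelli the Bessel operator is the average of the heat semigroup against [e^(-s) ds], a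
    probability measure on the positive half-line, so a bound valid at every time [s] survives. *)
Lemma besselOp_heat_ge n (x : 'rV[R]_n) (psi : R -> R) (c : R) :
  measurable_fun [set: mR] psi -> (forall a, 0 <= psi a) -> 0 <= c ->
  (forall s, 0 < s ->
     (c%:E <= intRn (fun y => (heat s (x - y) * psi (enorm y))%:E))%E) ->
  (c%:E <= besselOp (fun y => psi (enorm y)) x)%E.
Proof.
move=> mpsi psi0 c0 H.
pose F s (y : 'rV[R]_n) := (bessel_density n (s, enorm (x - y)) * (psi (enorm y))%:E)%E.
have F0 s y : (0 <= F s y)%E by rewrite mule_ge0 ?lee_fin// bessel_density_ge0.
have mF : mfam (T := mR) F.
  pose Phi (w : mR * (mR * mR)) := (bessel_density n (w.1, w.2.1) * (psi w.2.2)%:E)%E.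
  have -> : F = fun t y => Phi (t, (enorm (x - y), enorm (0 - y))).
    by apply/funext => s; apply/funext => y; rewrite /Phi /F/= sub0r enormN.
  apply: mfam_enorm; apply: emeasurable_funM.
    apply: (measurableT_comp (measurable_bessel_density n)).
    apply: measurable_fun_pair; first exact: measurable_fst.
    exact: (measurableT_comp measurable_fst measurable_snd).
  apply/measurable_EFinP; apply: (measurableT_comp mpsi).
  exact: (measurableT_comp measurable_snd measurable_snd).
have -> : besselOp (fun y => psi (enorm y)) x = (\int[mu]_s intRn (F s))%E.
  rewrite (intRn_tonelli _ _ mu F F0 mF); congr intRn; apply/funext => y.
  rewrite /F ge0_integralZr//; first by rewrite -besselE.
  - apply: (measurableT_comp (measurable_bessel_density n)).
    by apply: measurable_fun_pair.
  - by move=> s _; exact: bessel_density_ge0.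
  - by rewrite lee_fin.
have -> : c%:E = (c%:E * (\int[mu]_(s in [set s : R | (0 < s)%R]) (expR (- s))%:E))%E.
  by rewrite integral_expRN mule1.
have mD : measurable ([set s : R | (0 < s)%R] : set mR).
  rewrite (_ : mkset _ = `]0, +oo[%classic)//.
  by apply/seteqP; split => s /=; rewrite in_itv/= andbT.
rewrite -ge0_integralZl//; last first.
  by apply/measurable_funTS/measurable_EFinP; do 2 apply: measurableT_comp => //.
apply: le_lower_integral => //.
- by move=> s _; rewrite -EFinM lee_fin mulr_ge0 ?expR_ge0.
- by move=> s _; exact: intRn_ge0.
move=> s /= s0; rewrite muleC; apply: (@le_trans _ _ ((expR (- s))%:E *
    intRn (fun y => (heat s (x - y) * psi (enorm y))%:E))%E).
  by apply: lee_wpmul2l; [rewrite lee_fin expR_ge0|exact: H].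
apply: le_trans (intRnZ_le _ _ _ _) _; first by rewrite expR_ge0.
  by move=> y; rewrite lee_fin mulr_ge0// heat_ge0.
apply: le_intRn => y; first by rewrite -EFinM lee_fin mulr_ge0 ?expR_ge0// mulr_ge0// heat_ge0.
by rewrite /F bessel_densityE// -!EFinM mulrA.
Qed.

End BesselHeat.

(** * The truncated logarithmic potential *)

Section LogPotential.
Context {R : realType}.
Local Notation mu := (@lebesgue_measure R).
Local Notation mR := (measurableTypeR R).

Lemma measurable_invr : measurable_fun [set: mR] (fun x : mR => x^-1 : mR).
Proof.
have -> : (fun x : mR => x^-1 : mR) =
    fun x => if 0 <= x then x `^ (-1) else - ((- x) `^ (-1)).
  apply/funext => x; case: (leP 0 x) => x0; first by rewrite powR_inv1.
  by rewrite powR_inv1 ?oppr_ge0 ?ltW// invrN opprK.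
have mp := @measurable_powR R (-1).
apply: measurable_fun_ifT => //; first exact: measurable_fun_ler.
have mo : measurable_fun [set: mR] (fun x : mR => - x : mR) by exact: measurableT_comp.
exact: (measurableT_comp mo (measurableT_comp mp mo)).
Qed.

Lemma integral_scale (c : R) (f : R -> \bar R) : 0 < c ->
  measurable_fun [set: mR] f -> (forall a, (0 <= f a)%E) ->
  (\int[mu]_a f a = c^-1%:E * \int[mu]_a f (a / c)%R)%E.
Proof.
move=> c0 mf f0.
pose g : mR -> mR := fun a => a / c.
have mb : measurable_fun setT g by apply: measurable_funM.
pose mix := isMeasurableFun.Build _ _ _ _ g mb.
pose phi : {mfun mR >-> mR} := HB.pack g mix.
have cV0 : 0 <= c^-1 by rewrite invr_ge0 ltW.
pose cV : {nonneg R} := NngNum cV0.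
rewrite (eq_measure_integral (mscale cV (pushforward mu phi))).
  rewrite ge0_integral_mscale//=; congr (_ * _)%E.
  by rewrite ge0_integral_pushforward.
move=> A mA _; apply: lebesgue_measure_unique => // _ [[u v]] _ <-.
rewrite /= /mscale /= /pushforward.
have -> : g @^-1` `]u, v] = `](c * u)%R, (c * v)%R]%classic.
  apply/seteqP; split => x /=; rewrite !in_itv/=;
    by rewrite ltr_pdivlMr// ler_pdivrMr// ![c * _]mulrC.
rewrite !lebesgue_measure_itv/= !lte_fin ltr_pM2l//.
by case: ifP => // _; rewrite ?mule0// -!EFinB -EFinM; congr EFin; field; rewrite gt_eqF.
Qed.

(** A translation is the composition of two reflections. *)
Lemma integral_translate_le (c : R) (f : R -> \bar R) : (forall x, (0 <= f x)%E) ->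
  (\int[mu]_x f (x + c)%R <= \int[mu]_x f x)%E.
Proof.
move=> f0; apply: le_trans (integral_reflect_le c f f0).
apply: le_trans (integral_reflect_le 0 (fun a => f (c - a)%R) _) => //.
by under [leRHS]eq_integral do rewrite sub0r opprK addrC.
Qed.

Lemma integral_inv (a b : R) : 0 < a -> a < b ->
  (\int[mu]_(w in `]a, b]) (w^-1)%:E = (ln b - ln a)%:E)%E.
Proof.
move=> a0 ab; rewrite integral_itv_obnd_cbnd; last first.
  by apply/measurable_funTS/measurable_EFinP; exact: measurable_invr.
rewrite (@continuous_FTC2 R _ (@ln R))// ?EFinB//.
- apply: continuous_in_subspaceT => w; rewrite inE/= in_itv/= => /andP[aw _].
  by apply: cvgV => //; rewrite gt_eqF// (lt_le_trans a0).
- split.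
  + move=> w; rewrite in_itv/= => /andP[aw _].
    by apply: ex_derive; exact/is_derive1_ln/(lt_trans a0).
  + by apply: cvg_at_right_filter; exact: continuous_ln.
  + by apply: cvg_at_left_filter; apply: continuous_ln; exact: lt_trans ab.
- move=> w; rewrite in_itv/= => /andP[aw _].
  by rewrite derive1E; apply: derive_val; exact/is_derive1_ln/(lt_trans a0).
Qed.

Lemma integral_inv2 (a b : R) : 0 < a -> a < b ->
  (\int[mu]_(w in `]a, b]) (w^-2)%:E = (a^-1 - b^-1)%:E)%E.
Proof.
move=> a0 ab; rewrite integral_itv_obnd_cbnd; last first.
  apply/measurable_funTS/measurable_EFinP.
  have -> : (fun w : mR => w^-2) = fun w => (w^-1) ^+ 2.
    by apply/funext => w; rewrite exprVn.
  by apply: measurable_funX; exact: measurable_invr.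
have D (w : R) : a <= w -> is_derive w 1 (fun w : R => - w^-1) (w^-2).
  move=> aw; have wn0 : w != 0 by rewrite gt_eqF// (lt_le_trans a0).
  have -> : w^-2 = - (- w ^-2 *: 1) by rewrite scaleNr opprK /GRing.scale/= mulr1.
  apply: is_deriveN; exact: (@is_deriveV R (fun x => x)).
have C (w : R) : a <= w -> {for w, continuous (fun w : R => - w^-1)}.
  move=> aw; have [dw _] := D _ aw.
  by apply/differentiable_continuous/derivable1_diffP.
rewrite (@continuous_FTC2 R _ (fun w => - w^-1))// -?EFinB; first by rewrite opprK addrC.
- apply: continuous_in_subspaceT => w; rewrite inE/= in_itv/= => /andP[aw _].
  apply: cvgV => //; first by rewrite gt_eqF// exprn_gt0// (lt_le_trans a0).
  exact: exprn_continuous.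
- split.
  + by move=> w; rewrite in_itv/= => /andP[aw _]; apply: ex_derive; apply: D; exact: ltW.
  + by apply: cvg_at_right_filter; exact: C.
  + by apply: cvg_at_left_filter; apply: C; exact: ltW.
- move=> w; rewrite in_itv/= => /andP[aw _].
  by rewrite derive1E; apply: derive_val; apply: D; exact: ltW.
Qed.

(** For [rho > 0] this is the exponential integral [E_1(rho / M)], that is [- log rho] up to a
    constant depending on [M] and an error that vanishes as [M] grows. *)
Definition logpot (M rho : R) : \bar R :=
  (\int[mu]_(v in `]0%R, M]) (v^-1 * expR (- (rho / v)))%R%:E)%E.

Lemma measurable_logpot_density (rho : R) :
  measurable_fun [set: mR] (fun v : mR => (v^-1 * expR (- (rho / v)))%:E).
Proof.
have mo : measurable_fun [set: mR] (fun x : mR => - x : mR) by exact: measurableT_comp.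
apply/measurable_EFinP/measurable_funM; first exact: measurable_invr.
apply: (measurableT_comp (@measurable_expR R)); apply: (measurableT_comp mo).
by apply: measurable_funM => //; exact: measurable_invr.
Qed.

Lemma logpot_density_ge0 (rho v : R) : 0 <= v -> (0 <= (v^-1 * expR (- (rho / v)))%:E)%E.
Proof. by move=> v0; rewrite lee_fin mulr_ge0 ?expR_ge0 ?invr_ge0. Qed.

Lemma logpot_ge0 M rho : (0 <= logpot M rho)%E.
Proof.
apply: integral_ge0 => v /=; rewrite in_itv/= => /andP[v0 _].
by apply: logpot_density_ge0; exact: ltW.
Qed.

Lemma logpot_anti M rho rho' : rho <= rho' -> (logpot M rho' <= logpot M rho)%E.
Proof.
move=> rr; apply: le_lower_integral => // v /=; rewrite in_itv/= => /andP[v0 _].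
- by apply: logpot_density_ge0; exact: ltW.
- by apply: logpot_density_ge0; exact: ltW.
rewrite lee_fin; apply: ler_wpM2l; first by rewrite invr_ge0 ltW.
rewrite ler_expR lerN2.
by rewrite ler_wpM2r// invr_ge0 ltW.
Qed.

(** The measure [dv / v] is invariant under dilations. Values at two radii thus become two
    truncations of one integral, and their difference is an integral over an interval. *)
Lemma logpot_scale M rho : 0 < rho -> logpot M rho = logpot (M / rho) 1.
Proof.
move=> r0; rewrite /logpot integral_mkcond [in RHS]integral_mkcond.
set f := (X in _ = integral _ _ X).
have mf : measurable_fun [set: mR] f.
  apply/(measurable_restrictT _ _).1 => //.
  by apply: measurable_funTS; exact: measurable_logpot_density.
have f0 a : (0 <= f a)%E.
  rewrite /f /patch; case: ifPn => // /set_mem/=; rewrite in_itv/= => /andP[a0 _].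
  by apply: logpot_density_ge0; exact: ltW.
have cV0 : (0 <= (rho^-1)%:E)%E by rewrite lee_fin invr_ge0 ltW.
have mb : measurable_fun [set: mR] (fun a : mR => a / rho : mR) by apply: measurable_funM.
rewrite (integral_scale rho f)// -ge0_integralZl//; last first.
  exact: (measurableT_comp mf mb).
apply: eq_integral => v _; rewrite /f /patch.
have -> : ((v / rho : mR) \in `]0, M / rho]%classic) = ((v : mR) \in `]0, M]%classic).
  by apply/idP/idP => /set_mem/=; rewrite in_itv/= => h; apply/mem_set => /=;
    rewrite in_itv/=; move: h; rewrite ler_pdivrMr ?divfK ?gt_eqF// pmulr_lgt0 ?invr_gt0.
case: ifP => [/set_mem/=|]; last by rewrite mule0.
rewrite in_itv/= => /andP[v0 _]; rewrite -EFinM; congr EFin.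
by rewrite invf_div mul1r [RHS]mulrA [_ * (rho / v)]mulrA mulVf ?gt_eqF// mul1r.
Qed.

Lemma logpot_split (a b rho : R) : 0 < a -> a <= b ->
  (logpot b rho = logpot a rho + \int[mu]_(w in `]a, b]) (w^-1 * expR (- (rho / w)))%:E)%E.
Proof.
move=> a0 ab; rewrite /logpot.
rewrite (@itv_bndbnd_setU _ _ (BRight 0) (BRight a) (BRight b))//; last by rewrite bnd_simp ltW.
rewrite ge0_integral_setU//.
- by apply: measurable_funTS; exact: measurable_logpot_density.
- move=> x [|] /=; rewrite in_itv/= => /andP[h _]; apply: logpot_density_ge0.
    exact: ltW.
  by apply: ltW; exact: lt_trans h.
- apply/disj_setPS => x [] /=; rewrite !in_itv/= => /andP[_ xa] /andP[ax _].
  by move: (lt_le_trans ax xa); rewrite ltxx.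
Qed.

Lemma logpot_fin_num M X : 0 < M -> 0 < X -> logpot M X \is a fin_num.
Proof.
move=> M0 X0; rewrite ge0_fin_numE ?logpot_ge0//.
(* Since [e^(X / v) >= 1 + X / v >= X / v], the integrand is at most [1 / X]. *)
apply: (@le_lt_trans _ _ (\int[mu]_(v in `]0%R, M]) (X^-1)%:E)%E).
  apply: le_lower_integral => // v /=; rewrite in_itv/= => /andP[v0 _].
  - by apply: logpot_density_ge0; exact: ltW.
  - by rewrite lee_fin invr_ge0 ltW.
  rewrite lee_fin expRN -invfM lef_pV2 ?posrE ?mulr_gt0 ?expR_gt0//.
  have := expR_ge1Dx (X / v); rewrite -(ler_pM2l v0) => /(le_trans _); apply.
  by rewrite mulrDr mulr1 mulrCA divff ?gt_eqF// mulr1 lerDr ltW.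
by rewrite integral_cst// [X in (_ * X)%E]lebesgue_measure_itv/= lte_fin M0 -EFinB -EFinM ltry.
Qed.

(** After scaling, the two values differ by the integral of [e^(-1 / w) / w] between [M / rho] and
    [M / X]. For [X < rho] the exponential is bounded by 1; for [rho < X] it is at least
    [1 - 1 / w], and the loss [1 / w^2] integrates to [(X - rho) / M]. *)
Lemma logpot_le M X rho : 0 < M -> 0 < X -> 0 < rho ->
  (logpot M X <= logpot M rho + (ln rho - ln X + X / M)%:E)%E.
Proof.
move=> M0 X0 r0; rewrite (logpot_scale M X)// (logpot_scale M rho)//.
have XM0 : 0 <= X / M by rewrite divr_ge0 ?ltW.
have k0 (a : R) : 0 < a -> forall w, `]a, +oo[%classic w ->
    (0 <= (w^-1 * expR (- (1 / w)))%:E)%E.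
  move=> a0 w /=; rewrite in_itv/= andbT => aw; apply: logpot_density_ge0.
  by apply: ltW; exact: lt_trans aw.
case: (ltgtP rho X) => rX; last first.
- by rewrite rX subrr add0r leeDl// lee_fin -rX.
- have ab : M / rho < M / X by rewrite ltr_pM2l// ltf_pV2.
  have a0 : 0 < M / rho by rewrite divr_gt0.
  rewrite (logpot_split _ _ _ a0 (ltW ab)) leeD2l//.
  apply: (@le_trans _ _ (ln rho - ln X)%:E); last by rewrite lee_fin lerDl.
  rewrite (_ : ln rho - ln X = ln (M / X) - ln (M / rho)); last first.
    by rewrite !ln_div ?posrE//; ring.
  rewrite -integral_inv//; apply: le_lower_integral => // w /=;
      rewrite in_itv/= => /andP[aw _]; have w0 := lt_trans a0 aw.
  + by apply: logpot_density_ge0; exact: ltW.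
  + by rewrite lee_fin invr_ge0 ltW.
  have wV : 0 <= w^-1 by rewrite invr_ge0 ltW.
  by rewrite lee_fin ler_piMr// expR_le1 oppr_le0 mul1r.
- have ab : M / X < M / rho by rewrite ltr_pM2l// ltf_pV2.
  have a0 : 0 < M / X by rewrite divr_gt0.
  rewrite (logpot_split _ _ _ a0 (ltW ab)) -addeA -[leLHS]adde0 leeD2l//.
  set I := (X in (X + _)%E).
  suff H : ((ln (M / rho) - ln (M / X))%:E <= I + ((M / X)^-1 - (M / rho)^-1)%:E)%E.
    rewrite -leeBlDr// add0e -EFinN.
    apply: (@le_trans _ _ ((ln (M / rho) - ln (M / X))%:E -
      ((M / X)^-1 - (M / rho)^-1)%:E)%E).
      rewrite -EFinB lee_fin !ln_div ?posrE// !invf_div.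
      have : 0 <= rho / M by rewrite divr_ge0 ?ltW.
      lra.
    by rewrite leeBlDr.
  rewrite -integral_inv// -integral_inv2// /I -ge0_integralD//.
  + apply: le_lower_integral => // w /=; rewrite in_itv/= => /andP[aw _];
      have w0 := lt_trans a0 aw.
    * by rewrite lee_fin invr_ge0 ltW.
    * by rewrite adde_ge0// ?lee_fin ?mulr_ge0 ?invr_ge0 ?expR_ge0 ?exprn_ge0// ltW.
    rewrite -EFinD lee_fin.
    have : 0 <= w^-1 by rewrite invr_ge0 ltW.
    rewrite mul1r -exprVn; move: (w^-1) => z z0.
    have := ler_wpM2l z0 (expR_ge1Dx (- z)); lra.
  + move=> w /=; rewrite in_itv/= => /andP[aw _]; apply: logpot_density_ge0.
    by apply/ltW/(lt_trans a0).
  + by apply: measurable_funTS; exact: measurable_logpot_density.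
  + move=> w /=; rewrite in_itv/= => /andP[aw _].
    by rewrite lee_fin invr_ge0 exprn_ge0// ltW// (lt_trans a0).
  + apply/measurable_funTS/measurable_EFinP.
    have -> : (fun w : mR => w^-2) = fun w => (w^-1) ^+ 2.
      by apply/funext => w; rewrite exprVn.
    by apply: measurable_funX; exact: measurable_invr.
Qed.

End LogPotential.

(** * The truncated logarithm under the heat semigroup *)

Section Subharmonic.
Context {R : realType}.
Local Notation mu := (@lebesgue_measure R).
Local Notation mR := (measurableTypeR R).

(** As a function of [log rho], the power [rho^e] is convex and lies above its tangent at [log X],
    whose slope is [X^e e]; [logpot_le] then trades [log rho - log X] for the difference of the
    potentials. *)
Lemma powR_logpot (M X rho e : R) : 0 < M -> 0 < X -> 0 <= rho -> 0 < e ->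
  ((X `^ e)%:E + (X `^ e * e)%:E * logpot M X <=
   (rho `^ e)%:E + ((X `^ e * e)%:E * logpot M rho + (X `^ e * e * (X / M))%:E))%E.
Proof.
move=> M0 X0 r0 e0; set c := X `^ e * e.
have Xe0 : 0 < X `^ e by rewrite powR_gt0.
have c0 : 0 < c by rewrite mulr_gt0.
have := logpot_ge0 M rho.
have /fineK <- := logpot_fin_num M X M0 X0; set lX := fine _.
have key : forall r, 0 < r -> (lX%:E <= logpot M r + (ln r - ln X + X / M)%:E)%E.
  by move=> r rp; rewrite /lX fineK ?logpot_fin_num// logpot_le.
case E : (logpot M rho) => [lr| |] //= lr0; last first.
  by rewrite gt0_muley ?lte_fin// addye// addey// leey.
rewrite -!EFinM -!EFinD lee_fin.
move: r0; rewrite le_eqVlt => /predU1P[r0|r0].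
  (* At [rho = 0] the comparison is made at the radius [X e^(-1 / e)], where the tangent vanishes;
     monotonicity of [logpot] carries it to 0. *)
  have := key (X * expR (- e^-1)).
  rewrite mulr_gt0 ?expR_gt0// => /(_ isT) h.
  have h2 : (logpot M (X * expR (- e^-1)) <= lr%:E)%E.
    by rewrite -E -r0; apply: logpot_anti; rewrite mulr_ge0 ?expR_ge0 ?ltW.
  have := le_trans h (leeD2r _ h2).
  rewrite -EFinD lee_fin lnM ?posrE ?expR_gt0// expRK => h3.
  have h4 : c * lX <= c * (lr + (ln X + - e^-1 - ln X + X / M)) by rewrite ler_pM2l.
  have h5 : c * e^-1 = X `^ e by rewrite /c mulfK ?gt_eqF.
  have := powR_ge0 rho e; lra.
have := key rho r0; rewrite E -EFinD lee_fin => h.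
have h4 : c * lX <= c * (lr + (ln rho - ln X + X / M)) by rewrite ler_pM2l.
have -> : rho `^ e = X `^ e * expR (e * (ln rho - ln X)).
  rewrite /powR !gt_eqF// -expRD; congr expR; ring.
have := ler_wpM2l (ltW Xe0) (expR_ge1Dx (e * (ln rho - ln X))).
rewrite /c in h4 *; lra.
Qed.

Definition logpot_kernel (M : R) (w : mR * mR) : \bar R :=
  if (0 < w.2) && (w.2 <= M) then (w.2^-1 * expR (- (w.1 / w.2)))%:E else 0%E.

Lemma measurable_logpot_kernel M : measurable_fun setT (logpot_kernel M).
Proof.
have m1 : measurable_fun [set: mR * mR] (fun w : mR * mR => w.1 : R).
  exact: measurable_fst.
have m2 : measurable_fun [set: mR * mR] (fun w : mR * mR => w.2 : R).
  exact: measurable_snd.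
have m3 : measurable_fun [set: mR * mR] (fun w : mR * mR => w.2^-1 : R).
  exact: (measurableT_comp measurable_invr m2).
apply: measurable_fun_ifT => //.
  by apply: measurable_and; [exact: measurable_fun_ltr|exact: measurable_fun_ler].
apply/measurable_EFinP/measurable_funM => //.
apply: (measurableT_comp (@measurable_expR R)).
by apply: measurable_funN; exact: measurable_funM.
Qed.

Lemma logpot_kernel_ge0 M w : (0 <= logpot_kernel M w)%E.
Proof.
rewrite /logpot_kernel; case: ifP => // /andP[h _].
by apply: logpot_density_ge0; exact: ltW.
Qed.

Lemma logpotE M rho : logpot M rho = (\int[mu]_v logpot_kernel M (rho, v))%E.
Proof.
rewrite /logpot integral_mkcond; apply: eq_integral => v _.
rewrite /patch /logpot_kernel/=.
have [h|h] := boolP ((0 < v) && (v <= M)); first by rewrite mem_set.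
by rewrite memNset//= in_itv/=; exact/negP.
Qed.

Lemma measurable_logpot M : measurable_fun [set: mR] (logpot M).
Proof.
have -> : logpot M = fubini_F mu (logpot_kernel M).
  by apply/funext => rho; rewrite logpotE.
apply: measurable_fun_fubini_tonelli_F; first exact: measurable_logpot_kernel.
exact: logpot_kernel_ge0.
Qed.

Lemma measurable_heat n (s : R) : measurable_fun [set: mR]
  (fun u : mR => ((4 * pi * s) `^ (- (n%:R / 2)) * expR (- (u ^+ 2 / (4 * s)))) : R).
Proof.
apply: measurable_funM => //; apply: (measurableT_comp (@measurable_expR R)).
by apply: measurableT_comp => //; apply: measurable_funM.
Qed.

Lemma mfam_heat_radial {n} d (T : measurableType d) (s : R) (x z : 'rV[R]_n)
    (psi : T * mR -> \bar R) : measurable_fun setT psi ->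
  mfam (T := T) (fun t y => ((heat s (x - y))%:E * psi (t, enorm (z - y)))%E).
Proof.
move=> mpsi.
pose Phi (w : T * (mR * mR)) : \bar R :=
  (((4 * pi * s) `^ (- (n%:R / 2)) * expR (- (w.2.1 ^+ 2 / (4 * s))))%:E *
   psi (w.1, w.2.2))%E.
apply: (mfam_enorm _ _ Phi); apply: emeasurable_funM.
  apply/measurable_EFinP.
  apply: (measurableT_comp (measurable_heat n s)).
  exact: (measurableT_comp measurable_fst measurable_snd).
apply: (measurableT_comp mpsi); apply: measurable_fun_pair; first exact: measurable_fst.
exact: (measurableT_comp measurable_snd measurable_snd).
Qed.

(** The heat average of [e^(-|y|^2 / v) / v] is [w^(-n / 2) e^(-|x|^2 / (v + 4 s)) / v] with
    [w = 1 + 4 s / v]. As [n >= 2] and [v w = v + 4 s], this is at most the same profile with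
    [v + 4 s] for [v]. The truncation moves to [M + 4 s], and the added interval, of length [4 s],
    carries an integrand of at most [1 / M]. *)
Lemma heat_logpot_le n (M s : R) (x : 'rV[R]_n) : (2 <= n)%N -> 0 < M -> 0 < s ->
  0 < enorm x ->
  (intRn (fun y => (heat s (x - y))%:E * logpot M (enorm y ^+ 2)) <=
   logpot M (enorm x ^+ 2) + (4 * s / M)%:E)%E.
Proof.
move=> n2 M0 s0 x0; set X := enorm x ^+ 2.
have X0 : 0 < X by rewrite exprn_gt0.
pose F (v : mR) (y : 'rV[R]_n) :=
  ((heat s (x - y))%:E * logpot_kernel M (enorm (0 - y)%R ^+ 2, v)%R)%E.
have F0 v y : (0 <= F v y)%E by rewrite mule_ge0 ?lee_fin ?heat_ge0 ?logpot_kernel_ge0.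
have mF : mfam (T := mR) F.
  apply: (mfam_heat_radial _ _ _ _ _ (fun w : mR * mR => logpot_kernel M (w.2 ^+ 2, w.1))).
  apply: (measurableT_comp (measurable_logpot_kernel M)).
  apply: measurable_fun_pair; last exact: measurable_fst.
  by apply: measurable_funX; exact: measurable_snd.
have -> : intRn (fun y => (heat s (x - y))%:E * logpot M (enorm y ^+ 2))%E =
    (\int[mu]_v intRn (F v))%E.
  rewrite (intRn_tonelli _ _ mu F F0 mF); congr intRn; apply/funext => y.
  rewrite /F sub0r enormN ge0_integralZl//; first by rewrite -logpotE.
  - apply: (measurableT_comp (measurable_logpot_kernel M)).
    exact: measurable_fun_pair.
  - by move=> v _; exact: logpot_kernel_ge0.
  - by rewrite lee_fin heat_ge0.
pose g (v : R) : \bar R :=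
  if (4 * s < v) && (v <= M + 4 * s) then (v^-1 * expR (- (X / v)))%:E else 0%E.
have g0 v : (0 <= g v)%E.
  rewrite /g; case: ifP => // /andP[h _]; apply: logpot_density_ge0.
  by apply: ltW; apply: lt_trans h; rewrite mulr_gt0.
apply: (@le_trans _ _ (\int[mu]_v g (v + 4 * s)%R)%E).
  apply: le_lower_integral => // v _; first exact: intRn_ge0.
  rewrite /g ltrDr lerD2r /F /logpot_kernel/=.
  case: ifPn => [/andP[v0 _]|_]; last first.
    by under eq_fun do rewrite mule0; rewrite intRn0.
  have vV : 0 < v^-1 by rewrite invr_gt0.
  have -> : (fun y => (heat s (x - y))%:E *
      (v^-1 * expR (- (enorm (0 - y) ^+ 2 / v)))%:E)%E =
      fun y => ((v^-1)%:E * (heat s (x - y) * expR (- (v^-1 * enorm y ^+ 2)))%:E)%E.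
    apply/funext => y; rewrite sub0r enormN -!EFinM; congr EFin.
    by rewrite mulrCA; congr (_ * (_ * expR (- _))); rewrite mulrC.
  rewrite intRnZ ?(ltW vV)//; last first.
    by move=> y; rewrite lee_fin mulr_ge0 ?heat_ge0 ?expR_ge0.
  rewrite heat_gauss ?(ltW vV)// -EFinM lee_fin.
  set w := 1 + 4 * s * v^-1.
  have sv : 0 < 4 * s * v^-1 by rewrite !mulr_gt0.
  have w1 : 1 <= w by rewrite /w lerDl ltW.
  have w0 : 0 < w by exact: lt_le_trans w1.
  have vw : v * w = v + 4 * s by rewrite /w; field; rewrite gt_eqF.
  have -> : v^-1 * enorm x ^+ 2 / w = X / (v + 4 * s).
    by rewrite -vw /X; field; rewrite !gt_eqF.
  set EE := expR _.
  have -> : (v + 4 * s)^-1 = v^-1 * w^-1 by rewrite -invfM vw.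
  rewrite -[leRHS]mulrA; apply: ler_wpM2l; first exact: ltW.
  apply: ler_wpM2r; first exact: expR_ge0.
  have q0 : 0 <= w `^ (- (1 / 2)) by rewrite powR_ge0.
  have q2 : (w `^ (- (1 / 2))) ^+ 2 = w^-1.
    by rewrite -powR_mulrn// -powRrM (_ : - (1 / 2) * 2 = -1) ?powR_inv1 ?ltW//; field.
  rewrite -q2 ler_wiXn2l//.
  by rewrite powRN invf_le1 ?powR_gt0// -[leLHS](powRr0 w) ler_powR.
apply: le_trans (integral_translate_le (4 * s) g g0) _.
apply: (@le_trans _ _ (logpot (M + 4 * s) X)).
  rewrite logpotE; apply: le_lower_integral => // v _; first exact: logpot_kernel_ge0.
  rewrite /g /logpot_kernel/=; case: ifPn => [/andP[h ->]|_].
    by rewrite (lt_trans _ h) ?mulr_gt0.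
  by case: ifPn => // /andP[h _]; apply: logpot_density_ge0; exact: ltW.
have s4 : 0 < 4 * s by rewrite mulr_gt0.
rewrite (logpot_split M)// ?lerDl ?(ltW s4)// leeD2l//.
apply: (@le_trans _ _ (\int[mu]_(v in `]M, (M + 4 * s)%R]) (M^-1)%:E)%E).
  apply: le_lower_integral => // v /=; rewrite in_itv/= => /andP[Mv _].
  - by apply: logpot_density_ge0; exact/ltW/(lt_trans M0).
  - by rewrite lee_fin invr_ge0 ltW.
  have v0 := lt_trans M0 Mv.
  rewrite lee_fin -[leRHS]mulr1 ler_pM ?invr_ge0 ?expR_ge0 ?(ltW v0)//.
    by rewrite lef_pV2 ?posrE// ltW.
  by rewrite expR_le1 oppr_le0 divr_ge0 ?ltW.
rewrite integral_cst// [X in (_ * X)%E]lebesgue_measure_itv/= lte_fin ltrDl s4.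
by rewrite -EFinB -EFinM lee_fin addrAC subrr add0r mulrC.
Qed.

End Subharmonic.

(** * Subharmonicity of powers of the norm *)

Section Subharmonic2.
Context {R : realType}.
Local Notation mu := (@lebesgue_measure R).
Local Notation mR := (measurableTypeR R).

(** Integrating [powR_logpot] against the heat kernel and applying [heat_logpot_le] leaves an error
    [c (4 s + X) / M], which vanishes as [M] tends to infinity. *)
Lemma heat_powR_ge n (s d : R) (x : 'rV[R]_n) : (2 <= n)%N -> 0 < s -> 0 < d ->
  ((enorm x `^ d)%:E <= intRn (fun y => (heat s (x - y) * enorm y `^ d)%:E))%E.
Proof.
(* [mfam] speaks of families with a parameter; the ones below are constant in it, and [t0] is an
   arbitrary value. *)
move=> n2 s0 d0; pose t0 : mR := 0.
have I0 : (0 <= intRn (fun y : 'rV[R]_n => (heat s (x - y) * enorm y `^ d)%:E))%E.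
  by apply: intRn_ge0 => y; rewrite lee_fin mulr_ge0 ?heat_ge0 ?powR_ge0.
have [x0|x0] := eqVneq (enorm x) 0; first by rewrite x0 powR0 ?gt_eqF.
have xp : 0 < enorm x by rewrite lt0r x0 enorm_ge0.
pose e := d / 2; have e0 : 0 < e by rewrite divr_gt0.
pose X := enorm x ^+ 2; have X0 : 0 < X by rewrite exprn_gt0.
have dE (y : 'rV[R]_n) : enorm y `^ d = (enorm y ^+ 2) `^ e.
  by rewrite -powR_mulrn ?enorm_ge0// -powRrM /e; congr (_ `^ _); field.
rewrite dE -/X; set c := X `^ e * e.
have Xe0 : 0 < X `^ e by rewrite powR_gt0.
have c0 : 0 < c by rewrite mulr_gt0.
move: I0; set I := intRn _ => I0.
have main (M : R) : 0 < M -> ((X `^ e)%:E <= I + (c * ((4 * s + X) / M))%:E)%E.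
  move=> M0.
  pose f1 (t : mR) (y : 'rV[R]_n) := ((heat s (x - y))%:E * (enorm (0 - y) `^ d)%:E)%E.
  pose f2 (t : mR) (y : 'rV[R]_n) :=
    ((heat s (x - y))%:E * (c%:E * logpot M (enorm (0 - y)%R ^+ 2)))%E.
  pose f3 (t : mR) (y : 'rV[R]_n) := ((heat s (x - y))%:E * (c * (X / M))%:E)%E.
  have h0 (y : 'rV[R]_n) : (0 <= (heat s (x - y))%:E)%E by rewrite lee_fin heat_ge0.
  have hL y : (0 <= c%:E * logpot M y)%E by rewrite mule_ge0 ?logpot_ge0// lee_fin ltW.
  have hK : (0 <= (c * (X / M))%:E)%E by rewrite lee_fin mulr_ge0 ?divr_ge0 ?ltW.
  have f10 t y : (0 <= f1 t y)%E by rewrite mule_ge0// lee_fin powR_ge0.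
  have f20 t y : (0 <= f2 t y)%E.
    by rewrite mule_ge0// mule_ge0 ?logpot_ge0// lee_fin ltW.
  have f30 t y : (0 <= f3 t y)%E.
    by rewrite mule_ge0// lee_fin mulr_ge0 ?divr_ge0 ?ltW.
  have m1 : mfam f1.
    apply: (mfam_heat_radial _ _ _ _ _ (fun w : mR * mR => (w.2 `^ d)%:E)).
    apply/measurable_EFinP; apply: (measurableT_comp (@measurable_powR R d)).
    exact: measurable_snd.
  have m2 : mfam f2.
    apply: (mfam_heat_radial _ _ _ _ _ (fun w : mR * mR => (c%:E * logpot M (w.2 ^+ 2)%R)%E)).
    apply: emeasurable_funM => //; apply: (measurableT_comp (measurable_logpot M)).
    by apply: measurable_funX; exact: measurable_snd.
  have m3 : mfam f3.
    exact: (mfam_heat_radial _ _ _ _ 0 (fun w : mR * mR => (c * (X / M))%:E)).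
  have m23 : mfam (fun t y => (f2 t y + f3 t y)%E).
    have -> : (fun t y => (f2 t y + f3 t y)%E) = fun (t : mR) y => ((heat s (x - y))%:E *
        (c%:E * logpot M (enorm (0 - y)%R ^+ 2) + (c * (X / M))%:E))%E.
      by apply/funext => t; apply/funext => y; rewrite /f2 /f3 (ge0_muleDr _ (hL _) hK).
    apply: (mfam_heat_radial _ _ _ _ _
      (fun w : mR * mR => (c%:E * logpot M (w.2 ^+ 2)%R + (c * (X / M))%:E)%E)).
    apply: emeasurable_funD => //.
    apply: emeasurable_funM => //; apply: (measurableT_comp (measurable_logpot M)).
    by apply: measurable_funX; exact: measurable_snd.
  have L : ((X `^ e)%:E + c%:E * logpot M X <=
      intRn (fun y => f1 t0 y + (f2 t0 y + f3 t0 y)))%E.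
    have fX := logpot_fin_num M X M0 X0; rewrite -(fineK fX).
    have lX0 : 0 <= fine (logpot M X) by rewrite fine_ge0 ?logpot_ge0.
    have a0 : 0 <= X `^ e + c * fine (logpot M X).
      by rewrite addr_ge0 ?(ltW Xe0)// mulr_ge0// ltW.
    rewrite -EFinM -EFinD -[leLHS]mule1 -(intRn_heat n s x s0) -intRnZ//.
    apply: le_intRn => y; first by rewrite mule_ge0// lee_fin.
    rewrite EFinD EFinM fineK// muleC /f1 /f2 /f3 sub0r enormN dE.
    rewrite -(ge0_muleDr _ (hL _) hK) -ge0_muleDr; last 2 first.
    - by rewrite lee_fin powR_ge0.
    - exact: adde_ge0.
    apply: lee_wpmul2l => //.
    by apply: powR_logpot => //; rewrite sqr_ge0.
  rewrite (intRnD _ _ f1 (fun t y => f2 t y + f3 t y)%E) in L => //; last first.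
    by move=> t y; rewrite adde_ge0.
  rewrite (intRnD _ _ f2 f3) in L => //.
  have I1 : intRn (f1 t0) = I.
    by congr intRn; apply/funext => y; rewrite /f1 sub0r enormN -EFinM.
  have I2 : (intRn (f2 t0) <= c%:E * (logpot M X + (4 * s / M)%:E))%E.
    rewrite /f2; under eq_fun do rewrite muleCA sub0r enormN.
    rewrite intRnZ ?(ltW c0)//; last by move=> y; rewrite mule_ge0 ?logpot_ge0.
    by apply: lee_wpmul2l; [rewrite lee_fin ltW|exact: heat_logpot_le].
  have I3 : intRn (f3 t0) = (c * (X / M))%:E.
    rewrite /f3; under eq_fun do rewrite muleC.
    by rewrite intRnZ ?intRn_heat ?mule1// -lee_fin.
  rewrite I1 I3 in L; have {}L := le_trans L (leeD2l _ (leeD2r _ I2)).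
  (* Both sides contain [c * logpot M X], which is finite because [X > 0] and hence cancels. *)
  move: L; have fX := logpot_fin_num M X M0 X0; rewrite -(fineK fX).
  case: (I) I0 => [r| |] //= _; last by move=> _; rewrite addye// leey.
  rewrite -!EFinM -!EFinD !lee_fin => L.
  have -> : (4 * s + X) / M = 4 * s / M + X / M by rewrite mulrDl.
  lra.
case: (I) I0 main => [r| |] //= _ main; last by rewrite leey.
rewrite lee_fin; apply/ler_addgt0Pr => eps eps0.
(* The choice [M = Y / eps] makes the error exactly [eps]. *)
pose Y := c * (4 * s + X).
have Y0 : 0 < Y by rewrite mulr_gt0// addr_gt0// mulr_gt0.
have := main (Y / eps); rewrite divr_gt0// => /(_ isT).
rewrite -EFinD lee_fin; congr (_ <= _ + _).
by rewrite mulrA -/Y invf_div mulrCA divff ?mulr1// gt_eqF.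
Qed.

Lemma powR_midpoint (a b d : R) : 1 <= d ->
  `|(a + b) / 2| `^ d <= (`|a| `^ d + `|b| `^ d) / 2.
Proof.
move=> d1; apply: (@le_trans _ _ ((2^-1 * `|a| + (1 - 2^-1) * `|b|) `^ d)).
  rewrite ge0_ler_powR ?nnegrE ?(le_trans _ d1)//.
    by rewrite addr_ge0// mulr_ge0// subr_ge0 invf_le1 ?ler1n.
  rewrite normrM [`|2^-1|]ger0_norm//; have := ler_normD a b; lra.
have h0 : 0 <= 2^-1 :> R by [].
have h1 : 2^-1 <= 1 :> R by lra.
have := convex_powR d1 (Itv01 h0 h1) (x := `|a|) (y := `|b|).
rewrite !inE/= !in_itv/= !normr_ge0 => /(_ isT isT).
by rewrite !convRE/= => /le_trans; apply; rewrite /unstable.onem; lra.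
Qed.

(** The heat kernel centred at [x] is invariant under [y |-> 2 x - y], so the average of
    [|2 x - y|^d] is at most that of [|y|^d]; averaging the midpoint inequality then gives twice the
    claim. *)
Lemma heat_powR_midconvex n (s d : R) (x : 'rV[R]_n) : 0 < s ->
  (forall y : 'rV[R]_n, 2 * enorm x `^ d <= enorm y `^ d + enorm (x + x - y) `^ d) ->
  ((enorm x `^ d)%:E <= intRn (fun y => (heat s (x - y) * enorm y `^ d)%:E))%E.
Proof.
move=> s0 mid; pose t0 : mR := 0.
pose g (t : mR) (y : 'rV[R]_n) := ((heat s (x - y))%:E * (enorm (0 - y) `^ d)%:E)%E.
pose g' (t : mR) (y : 'rV[R]_n) := ((heat s (x - y))%:E * (enorm (x + x - y) `^ d)%:E)%E.
have m z : mfam (fun (t : mR) (y : 'rV[R]_n) =>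
    ((heat s (x - y))%:E * (enorm (z - y) `^ d)%:E)%E).
  apply: (mfam_heat_radial _ _ _ _ z (fun w : mR * mR => (w.2 `^ d)%:E)).
  apply/measurable_EFinP; apply: (measurableT_comp (@measurable_powR R d)).
  exact: measurable_snd.
have p z (t : mR) (y : 'rV[R]_n) :
    (0 <= (heat s (x - y))%:E * (enorm (z - y) `^ d)%:E)%E.
  by rewrite mule_ge0 ?lee_fin ?heat_ge0 ?powR_ge0.
have gE : intRn (fun y => (heat s (x - y) * enorm y `^ d)%:E) = intRn (g t0).
  by congr intRn; apply/funext => y; rewrite /g sub0r enormN EFinM.
have gg' : (intRn (g' t0) <= intRn (g t0))%E.
  apply: le_trans (intRn_reflect_le (x + x) (g t0) (p 0 t0)).
  apply: le_intRn => y; first exact: p.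
  rewrite /g /g' sub0r enormN /heat.
  have -> : x - (x + x - y) = - (x - y) by apply/rowP => i; rewrite !mxE; ring.
  by rewrite enormN.
have L : ((2 * enorm x `^ d)%:E <= intRn (fun y => g t0 y + g' t0 y))%E.
  have k0 : 0 <= 2 * enorm x `^ d by apply: mulr_ge0; [exact: ler0n|exact: powR_ge0].
  have h0 (y : 'rV[R]_n) : (0 <= (heat s (x - y))%:E)%E by rewrite lee_fin heat_ge0.
  rewrite -[leLHS]mule1 -(intRn_heat n s x s0) -(intRnZ _ _ k0 h0).
  apply: le_intRn => y; first by rewrite mule_ge0.
  rewrite /g /g' -!EFinM -EFinD lee_fin -mulrDr mulrC sub0r enormN.
  by apply: ler_wpM2l; [exact: heat_ge0|exact: mid].
rewrite (intRnD _ _ g g' t0 (p 0) (p (x + x)) (m 0) (m (x + x))) in L.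
rewrite gE; have {}L := le_trans L (leeD2l _ gg').
have I0 : (0 <= intRn (g t0))%E by apply: intRn_ge0; exact: p.
case: (intRn (g t0)) I0 L => [r| |] //= _; last by move=> _; rewrite leey.
rewrite -EFinD !lee_fin; lra.
Qed.

Lemma enorm_midconvex1 (d : R) (x y : 'rV[R]_1) : 1 <= d ->
  2 * enorm x `^ d <= enorm y `^ d + enorm (x + x - y) `^ d.
Proof.
move=> d1.
have e1 (z : 'rV[R]_1) : enorm z = `|z ord0 ord0|.
  by rewrite /enorm big_ord1 sqrtr_sqr.
rewrite !e1 !mxE; move: (x ord0 ord0) (y ord0 ord0) => a b.
have := powR_midpoint b (a + a - b) d d1.
by rewrite (_ : (b + (a + a - b)) / 2 = a); [lra|field].
Qed.

(** For [d = 0] this is conservation of mass. Otherwise [Jplus] gives [d >= 1] when [n = 1], where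
    convexity applies, and [d > 0] when [n >= 2], where the logarithmic potential applies. *)
Lemma besselOp_powR_ge n (d : R) (x : 'rV[R]_n) : (1 <= n)%N -> Jplus n d ->
  ((enorm x `^ d)%:E <= besselOp (fun y => (enorm y `^ d)%R) x)%E.
Proof.
move=> n1 Jd; apply: (besselOp_heat_ge n x (fun a => a `^ d) _ (measurable_powR _)).
- by move=> a; exact: powR_ge0.
- exact: powR_ge0.
move=> s s0.
have d0 : 0 <= d.
  by move: Jd; rewrite /Jplus; case: ifP => // _ [->//|]; exact: le_trans.
have [->|dn0] := eqVneq d 0.
  by rewrite powRr0; under eq_fun do rewrite powRr0 mulr1; rewrite intRn_heat.
case: n x n1 Jd => [//|[|n]] x _ Jd.
  have d1 : 1 <= d.
    by move: Jd; rewrite /Jplus eqxx => -[d00|//]; rewrite d00 eqxx in dn0.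
  by apply: heat_powR_midconvex s0 _ => y; exact: enorm_midconvex1.
by apply: heat_powR_ge => //; rewrite lt0r dn0.
Qed.

End Subharmonic2.

(** * Integration in time *)

Section TimeIntegrals.
Context {R : realType}.
Local Notation mu := (@lebesgue_measure R).

(** The absolute value is there because the power of a negative base is a default value that does
    not tend to 0 at 0. *)
Lemma continuous_norm_powR (e : R) : 0 < e -> continuous (fun x : R => `|x| `^ e).
Proof.
move=> e0 x; have en0 : e != 0 by rewrite gt_eqF.
have [->|x0] := eqVneq x 0.
  rewrite /continuous_at normr0 powR0//.
  suff : (fun x : R => `|x| `^ e) x @[x --> (0 : R)] --> (0 : R) by [].
  apply/cvgrPdist_lt => eps eps0.
  near=> y; rewrite sub0r normrN ger0_norm ?powR_ge0//.
  rewrite -[ltRHS]powRr1 ?ltW// -(mulVf en0) powRrM.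
  apply: gt0_ltr_powR => //; rewrite ?nnegrE ?powR_ge0//.
  by near: y; apply: (@nbhs0_lt R R); exact: powR_gt0.
apply: (@continuous_comp _ _ _ (fun x : R => `|x|) (fun y => y `^ e)).
  exact: norm_continuous.
have xp : 0 < `|x| by rewrite normr_gt0.
have [dp _] := is_derive1_powR e xp.
exact/differentiable_continuous/derivable1_diffP.
Unshelve. all: by end_near. Qed.

Variables (Lam : R -> R) (T : R).
Hypothesis T0 : 0 < T.
Hypothesis cLam : {within `[0, T], continuous Lam}.
Hypothesis Lam_gt0 : forall t, 0 <= t <= T -> 0 < Lam t.

Definition primitive (t : R) : R := Rintegral mu `[0, t]%classic Lam.
Local Notation I := primitive.

Let intLam : mu.-integrable `[0, T] (EFin \o Lam).
Proof. by apply: continuous_compact_integrable => //; exact: segment_compact. Qed.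

Lemma primitive0 : I 0 = 0.
Proof. by rewrite /primitive set_itv1 Rintegral_set1. Qed.

Lemma primitive_continuous : {within `[0, T], continuous I}.
Proof. exact: (parameterized_integral_continuous (ltW T0) intLam). Qed.

Lemma primitive_is_derive t : 0 < t < T -> is_derive t 1 I (Lam t).
Proof.
move=> /andP[t0 tT].
have cf : {for t, continuous Lam}.
  by apply: (within_continuous_continuous T0 cLam); rewrite in_itv/= t0.
have [d1 d2] := continuous_FTC1_closed tT intLam t0 cf.
by split; [exact: d1|rewrite -derive1E; exact: d2].
Qed.

Lemma primitive_mono s t : 0 <= s -> s < t -> t <= T -> I s < I t.
Proof.
move=> s0 st tT; rewrite -subr_gt0.
have cI : {within `[s, t], continuous I}.
  apply: continuous_subspaceW primitive_continuous => x /=; rewrite !in_itv/= => /andP[sx xt].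
  by rewrite (le_trans s0 sx) (le_trans xt tT).
have dI x : x \in `]s, t[ -> is_derive x 1 I (Lam x).
  rewrite in_itv/= => /andP[sx xt]; apply: primitive_is_derive.
  by rewrite (le_lt_trans s0 sx) (lt_le_trans xt tT).
have [c] := MVT st dI cI.
rewrite in_itv/= => /andP[sc ct] ->; rewrite mulr_gt0 ?subr_gt0//.
by apply: Lam_gt0; rewrite (ltW (le_lt_trans s0 sc)) (ltW (lt_le_trans ct tT)).
Qed.

Lemma primitive_homo s t : 0 <= s -> s <= t -> t <= T -> I s <= I t.
Proof.
by move=> s0; rewrite le_eqVlt => /predU1P[->//|st] tT; exact/ltW/primitive_mono.
Qed.

Section Power.
Variables (s t a : R).
Hypotheses (s0 : 0 <= s) (st : s < t) (tT : t <= T) (a1 : 1 < a).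

Let sub : `[s, t] `<=` `[0, T].
Proof.
move=> x /=; rewrite !in_itv/= => /andP[sx xt].
by rewrite (le_trans s0 sx) (le_trans xt tT).
Qed.

Lemma within_primitive_powR e : 0 < e ->
  {within `[s, t], continuous (fun x => (I x - I s) `^ e)}.
Proof.
move=> e0; apply: (@subspace_eq_continuous _ _ _ (fun x => `|I x - I s| `^ e)).
  move=> x; rewrite inE/= in_itv/= => /andP[sx xt].
  by rewrite ger0_norm// subr_ge0 primitive_homo// (le_trans xt tT).
move=> x; apply: (@continuous_comp _ _ _ (fun x : subspace `[s, t] => I x - I s)
  (fun y => `|y| `^ e)); last exact: continuous_norm_powR.
apply: (@cvgB _ R^o); last exact: cvg_cst.
exact: (continuous_subspaceW sub primitive_continuous).
Qed.

Let g x := a * (Lam x * (I x - I s) `^ (a - 1)).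
Let G x := (I x - I s) `^ a.

Let cg : {within `[s, t], continuous g}.
Proof.
move=> x; apply: cvgMl_tmp; apply: cvgM; first exact: (continuous_subspaceW sub cLam).
by apply: within_primitive_powR; rewrite subr_gt0.
Qed.

Let cG : {within `[s, t], continuous G}.
Proof. by apply: within_primitive_powR; rewrite (lt_trans _ a1). Qed.

Let dG x : x \in `]s, t[ -> is_derive x 1 G (g x).
Proof.
rewrite in_itv/= => /andP[sx xt].
have x0 : 0 < x < T by rewrite (le_lt_trans s0 sx) (lt_le_trans xt tT).
have p0 : 0 < I x - I s.
  by rewrite subr_gt0 primitive_mono// ltW// (lt_le_trans xt tT).
have := primitive_is_derive x x0 => dI.
have dB : is_derive x 1 (fun y => I y - I s) (Lam x).
  by apply: is_derive_eq; rewrite subr0.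
have h : is_derive x 1 ((fun z : R => z `^ a) \o (fun y => I y - I s))
    (a * (I x - I s) `^ (a - 1) * Lam x).
  by apply: is_derive1_comp; exact: is_derive1_powR.
have <- : a * (I x - I s) `^ (a - 1) * Lam x = g x by rewrite /g; ring.
exact: h.
Qed.

(** The fundamental theorem of calculus for [(I x - I s)^a]. As [a > 1], the exponent [a - 1] is
    positive and the derivative stays continuous at [s], where the base vanishes. *)
Lemma integral_primitive_powR :
  (\int[mu]_(x in `[s, t]) (a * (Lam x * (I x - I s) `^ (a - 1)))%:E =
   ((I t - I s) `^ a)%:E)%E.
Proof.
rewrite (@continuous_FTC2 _ g G)//.
- by rewrite /G subrr powR0 ?sube0// gt_eqF// (lt_trans _ a1).
- have [_ h1 h2] := (continuous_within_itvP _ st).1 cG; split; [|exact: h1|exact: h2].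
  by move=> x /dG dx; exact: ex_derive.
- by move=> x /dG [_ <-]; rewrite derive1E.
Qed.

Lemma integral_expR_primitive_powR :
  (\int[mu]_(x in `[s, t])
      (expR x * (I x - I s) `^ a + expR x * (a * (Lam x * (I x - I s) `^ (a - 1))))%:E =
   (expR t * (I t - I s) `^ a)%:E)%E.
Proof.
have cE : {within `[s, t], continuous (@expR R)}.
  exact/continuous_subspaceT/continuous_expR.
rewrite (@continuous_FTC2 _ (fun x => expR x * G x + expR x * g x) (fun x => expR x * G x))//.
- by rewrite /G subrr powR0 ?mulr0 ?sube0// gt_eqF// (lt_trans _ a1).
- move=> x; apply: cvgD; apply: cvgM;
    [exact: cE|exact: cG|exact: cE|exact: cg].
- have cEG : {within `[s, t], continuous (fun x => expR x * G x)}.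
    by move=> x; apply: cvgM; [exact: cE|exact: cG].
  have [_ h1 h2] := (continuous_within_itvP _ st).1 cEG; split; [|exact: h1|exact: h2].
  by move=> x /dG dx; apply: ex_derive.
- move=> x /dG dx; rewrite derive1E.
  have h : is_derive x 1 (fun x => expR x * G x) (expR x * g x + G x * expR x).
    exact: (@is_deriveM _ _ expR G).
  by rewrite derive_val addrC (mulrC (G x)).
Qed.

(** The two halves of the derivative of [e^x (I x - I s)^a] are kept apart because the linear term
    will supply the first and the source term the second. *)
Lemma integral_expR_primitive_powR_split :
  ((\int[mu]_(x in `[s, t]) (expR x * (I x - I s) `^ a)%:E) +
   (\int[mu]_(x in `[s, t]) (expR x * (a * (Lam x * (I x - I s) `^ (a - 1))))%:E) =
   (expR t * (I t - I s) `^ a)%:E)%E.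
Proof.
have cE : {within `[s, t], continuous (@expR R)}.
  exact/continuous_subspaceT/continuous_expR.
apply: etrans integral_expR_primitive_powR; apply/esym.
under eq_integral do rewrite EFinD.
apply: ge0_integralD; first exact: measurable_itv.
- by move=> x _; rewrite lee_fin mulr_ge0 ?expR_ge0 ?powR_ge0.
- apply/measurable_EFinP; apply: subspace_continuous_measurable_fun.
    exact: measurable_itv.
  by move=> x; apply: cvgM; [exact: cE|exact: cG].
- move=> x /sub; rewrite /= in_itv/= => xT; rewrite lee_fin.
  apply: mulr_ge0; first exact: expR_ge0.
  apply: mulr_ge0; first by rewrite (le_trans _ (ltW a1)).
  by apply: mulr_ge0; [exact/ltW/Lam_gt0|exact: powR_ge0].
- apply/measurable_EFinP; apply: subspace_continuous_measurable_fun.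
    exact: measurable_itv.
  by move=> x; apply: cvgM; [exact: cE|exact: cg].
Qed.

End Power.
End TimeIntegrals.

(** * Lower bounds for the Bessel operator *)

Section BesselOperator.
Context {R : realType}.

Lemma besselOp_ge0 n (phi : 'rV[R]_n -> R) x : (forall y, 0 <= phi y) ->
  (0 <= besselOp phi x)%E.
Proof.
by move=> phi0; apply: intRn_ge0 => y; rewrite mule_ge0 ?bessel_ge0 ?lee_fin.
Qed.

Lemma le_besselOp n (phi psi : 'rV[R]_n -> R) x : (forall y, 0 <= phi y) ->
  (forall y, phi y <= psi y) -> (besselOp phi x <= besselOp psi x)%E.
Proof.
move=> phi0 le; apply: le_intRn => y; first by rewrite mule_ge0 ?bessel_ge0 ?lee_fin.
by apply: lee_wpmul2l; [exact: bessel_ge0|rewrite lee_fin].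
Qed.

Lemma besselOpZ n (c : R) (phi : 'rV[R]_n -> R) x : 0 <= c -> (forall y, 0 <= phi y) ->
  besselOp (fun y => c * phi y) x = (c%:E * besselOp phi x)%E.
Proof.
move=> c0 phi0; rewrite /besselOp -intRnZ//.
  by congr intRn; apply/funext => y; rewrite EFinM muleCA.
by move=> y; rewrite mule_ge0 ?bessel_ge0 ?lee_fin.
Qed.

(** The spatial profile that [V mu^p] inherits from a bound of [mu] by [w]; the cut-off is at
    [|y| = 1] because the growth of [V] is known only beyond it. *)
Definition source_weight {n} (p sigma : R) (w : 'rV[R]_n -> R) (y : 'rV[R]_n) : R :=
  if 1 <= enorm y then enorm y `^ sigma * w y `^ p else 0.

Lemma source_weight_ge0 n p sigma (w : 'rV[R]_n -> R) y : 0 <= source_weight p sigma w y.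
Proof. by rewrite /source_weight; case: ifP => // _; rewrite mulr_ge0 ?powR_ge0. Qed.

(** Only the times [1 <= s <= 2] are kept; there the exponential and the power are smallest at
    [s = 2], the Gaussian at [s = 1]. *)
Lemma bessel_gauss_ge n : exists2 c : R, 0 < c &
  forall z : 'rV[R]_n, ((c * expR (- (enorm z ^+ 2 / 4)))%:E <= bessel z)%E.
Proof.
have pi0 : 0 < pi :> R := pi_gt0 R.
exists (expR (- 2) * (4 * pi * 2) `^ (- (n%:R / 2))).
  by rewrite mulr_gt0 ?expR_gt0 ?powR_gt0// !mulr_gt0.
move=> z; set c := _ * _ * _.
have c0 : 0 <= c by rewrite !mulr_ge0 ?expR_ge0 ?powR_ge0.
have -> : (c%:E = \int[lebesgue_measure]_(s in `[1%R, 2%R]) c%:E)%E.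
  rewrite integral_cst//= [X in (_ * X)%E]lebesgue_measure_itv/= lte_fin ltr1n.
  by rewrite -EFinB -EFinM; congr EFin; lra.
rewrite besselE; apply: le_lower_integral => //.
- by move=> s _; exact: bessel_density_ge0.
move=> s; rewrite /= in_itv/= => /andP[s1 s2].
have s0 : 0 < s by exact: lt_le_trans s1.
rewrite bessel_densityE// lee_fin /c /heat -mulrA.
apply: ler_pM; rewrite ?expR_ge0// ?mulr_ge0 ?expR_ge0 ?powR_ge0//.
  by rewrite ler_expR lerN2.
apply: ler_pM; rewrite ?expR_ge0 ?powR_ge0//.
  rewrite !powRN lef_pV2 ?posrE ?powR_gt0 ?mulr_gt0//.
  apply: ge0_ler_powR; rewrite ?nnegrE ?divr_ge0//.
  - by apply: mulr_ge0; [apply: mulr_ge0|]; exact: ltW.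
  - by apply: mulr_ge0; [apply: mulr_ge0|]; exact: ltW.
  - by apply: ler_wpM2l => //; apply: mulr_ge0; exact: ltW.
rewrite ler_expR lerN2; apply: ler_wpM2l; first by rewrite sqr_ge0.
by rewrite lef_pV2 ?posrE ?mulr_gt0// ler_peMr.
Qed.

Lemma enorm_sub_sqr_le n (x y : 'rV[R]_n) :
  enorm (x - y) ^+ 2 <= 2 * enorm x ^+ 2 + 2 * enorm y ^+ 2.
Proof.
rewrite !enorm_sqr !mulr_sumr -big_split/=; apply: ler_sum => i _; rewrite !mxE.
by have := sqr_ge0 (x ord0 i + y ord0 i); lra.
Qed.

(** By continuity [u0] is at least [u0 x1 / 2] on a cube around a point [x1] with [u0 x1 > 0]. There
    [|y|^2] is bounded by [Y], and [|x - y|^2 <= 2 |x|^2 + 2 |y|^2] separates the variables in the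
    Gaussian bound for the kernel. *)
Lemma besselOp_gauss_ge n (u0 : 'rV[R]_n -> R) : (forall x, 0 <= u0 x) ->
  continuous u0 -> (exists x, u0 x != 0) ->
  exists2 c : R, 0 < c &
    forall x, ((c * expR (- (1 / 2 * enorm x ^+ 2)))%:E <= besselOp u0 x)%E.
Proof.
move=> u00 cu0 [x1 x1n0].
have u1 : 0 < u0 x1 by rewrite lt0r x1n0 u00.
have [r r0 Hr] : exists2 r : R, 0 < r & forall y : 'rV[R]_n,
    (forall i, `|y ord0 i - x1 ord0 i| < r) -> u0 x1 / 2 <= u0 y.
  have : \forall y \near x1, u0 x1 / 2 < u0 y.
    by apply: (cvgr_gt _ (cu0 x1)); lra.
  move=> /nbhs_ballP[r /= r0 Hr].
  exists r => // y Hy; apply/ltW/Hr; rewrite /ball/= /mx_ball; split => // i j.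
  by rewrite ord1 /ball/= distrC.
have [c c0 Hc] := bessel_gauss_ge n.
pose Y := \sum_(i < n) (`|x1 ord0 i| + r) ^+ 2.
pose k := c * expR (- (Y / 2)) * (u0 x1 / 2).
have k0 : 0 < k by rewrite mulr_gt0 ?divr_gt0// mulr_gt0 ?expR_gt0.
exists (k * (2 * r) ^+ n); first by rewrite mulr_gt0// exprn_gt0// mulr_gt0.
move=> x; rewrite mulrAC; apply: intRn_box (ltW r0) _ _.
- by rewrite mulr_ge0 ?expR_ge0// ltW.
- by move=> y; rewrite mule_ge0 ?bessel_ge0// lee_fin.
move=> y Hy; apply: (@le_trans _ _
    ((c * expR (- (enorm (x - y) ^+ 2 / 4)))%:E * (u0 x1 / 2)%:E)%E); last first.
  apply: lee_pmul => //; rewrite ?lee_fin ?mulr_ge0 ?expR_ge0 ?divr_ge0//; last exact: Hr.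
  exact: ltW.
rewrite -EFinM lee_fin /k.
rewrite [leLHS](_ : _ = c * (expR (- (Y / 2)) * expR (- (1 / 2 * enorm x ^+ 2))) * (u0 x1 / 2));
  last by ring.
apply: ler_wpM2r; first by rewrite divr_ge0// ltW.
apply: ler_wpM2l; first exact: ltW.
rewrite -expRD ler_expR.
have yY : enorm y ^+ 2 <= Y.
  rewrite enorm_sqr; apply: ler_sum => i _; rewrite -(real_normK (num_real (y ord0 i))).
  rewrite lerXn2r ?nnegrE ?addr_ge0 ?(ltW r0)//.
  have := ler_normD (y ord0 i - x1 ord0 i) (x1 ord0 i); rewrite subrK => /le_trans; apply.
  by rewrite addrC lerD2l ltW.
have := enorm_sub_sqr_le n x y; lra.
Qed.

(** The exponent [lam] shrinks by the fixed factor [(1 + p) / 2 < 1] while [k] is uniform in [lam];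
    this is what lets the Gaussian weights flatten out under iteration. *)
Lemma besselOp_source_gauss_ge n (p sigma : R) : (1 <= n)%N -> 0 < p -> p < 1 ->
  0 <= sigma -> exists2 k : R, 0 < k & forall lam, 0 <= lam <= 1 / 2 ->
  forall x : 'rV[R]_n, ((k * expR (- ((1 + p) / 2 * lam * enorm x ^+ 2)))%:E <=
    besselOp (source_weight p sigma (fun y => expR (- (lam * enorm y ^+ 2)))) x)%E.
Proof.
move=> n1 p0 p1 sg0.
have [c c0 Hc] := bessel_gauss_ge n.
(* Chosen so that [p (1 + dl) = (1 + p) / 2]: the power [p] leaves room for the loss in
   [|y|^2 <= (1 + dl) |x|^2 + D]. *)
pose dl := (1 - p) / (2 * p).
have dl0 : 0 < dl by rewrite divr_gt0 ?subr_gt0// mulr_gt0.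
have pdl : p * (1 + dl) = (1 + p) / 2 by rewrite /dl; field; rewrite gt_eqF.
pose D := 4 * (1 + dl^-1) * n%:R.
have D0 : 0 <= D by rewrite mulr_ge0// mulr_ge0// addr_ge0// invr_ge0 ltW.
pose k := c * expR (- n%:R) * expR (- (p * D / 2)).
have k0 : 0 < k by rewrite mulr_gt0 ?expR_gt0// mulr_gt0 ?expR_gt0.
exists k => // lam /andP[l0 l1] x.
(* Each coordinate of [x] is pushed away from 0 by [3 / 2]. The unit cube around [b] then stays in
   [|y| >= 1] and within bounded distance of [x]. *)
pose b : 'rV[R]_n := \row_i (x ord0 i + (if 0 <= x ord0 i then 1 else -1) * (3 / 2)).
set e := expR _.
have -> : k * e = k * e * (2 * (1 / 2)) ^+ n.
  by rewrite (_ : 2 * (1 / 2) = 1) ?expr1n ?mulr1//; field.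
apply: (intRn_box _ _ b).
- by rewrite mulr_ge0 ?expR_ge0// ltW.
- by [].
- by move=> y; rewrite mule_ge0 ?bessel_ge0// lee_fin source_weight_ge0.
move=> y Hy.
have Hi i : [/\ 1 <= `|y ord0 i|, `|x ord0 i - y ord0 i| <= 2 &
    `|y ord0 i| <= `|x ord0 i| + 2].
  have := Hy i; rewrite mxE; move: (x ord0 i) (y ord0 i) => u v.
  have := ler_norm v; have := ler_norm (- v); have := ler_norm u; have := ler_norm (- u).
  rewrite !normrN ltr_norml => hu1 hu2 hv1 hv2.
  by case: ifPn => [u0|]; rewrite -?ltNge; [|move=> u0] => /andP[h1 h2]; split;
    rewrite ?(ler_norml (u - v)) ?(ler_norml v); try apply/andP; try split; lra.
have xy : enorm (x - y) ^+ 2 <= 4 * n%:R.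
  rewrite enorm_sqr (_ : 4 * n%:R = \sum_(i < n) 4); last first.
    by rewrite sumr_const card_ord mulr_natr.
  apply: ler_sum => i _; have [_ h _] := Hi i; rewrite !mxE.
  rewrite -(real_normK (num_real (x ord0 i - y ord0 i))) (_ : 4 = 2 ^+ 2); last by ring.
  by rewrite lerXn2r ?nnegrE.
have yD : enorm y ^+ 2 <= (1 + dl) * enorm x ^+ 2 + D.
  rewrite !enorm_sqr mulr_sumr (_ : D = \sum_(i < n) (4 * (1 + dl^-1))); last first.
    by rewrite sumr_const card_ord /D mulr_natr.
  rewrite -big_split/=; apply: ler_sum => i _; have [_ _ h] := Hi i.
  rewrite -(real_normK (num_real (y ord0 i))) -(real_normK (num_real (x ord0 i))).
  move: (normr_ge0 (y ord0 i)) (normr_ge0 (x ord0 i)) h.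
  move: `|y ord0 i| `|x ord0 i| => v u v0 u0 h.
  apply: (@le_trans _ _ ((u + 2) ^+ 2)); first by rewrite lerXn2r ?nnegrE// addr_ge0.
  (* (u + 2)^2 <= (1 + dl) u^2 + 4 (1 + 1/dl) by AM-GM on the cross term *)
  rewrite -subr_ge0 (_ : _ - _ = dl * (u - 2 / dl) ^+ 2); last by field; rewrite gt_eqF.
  by rewrite mulr_ge0 ?sqr_ge0// ltW.
have y1 : 1 <= enorm y.
  have [h _ _] := Hi (Ordinal n1).
  rewrite -(ler_pXn2r (ltn0Sn 1)) ?nnegrE ?enorm_ge0// expr1n enorm_sqr.
  rewrite (bigD1 (Ordinal n1))//= -[leLHS]addr0 lerD//; last first.
    by apply: sumr_ge0 => i _; rewrite sqr_ge0.
  by rewrite -(real_normK (num_real _)) -[leLHS](expr1n _ 2) lerXn2r ?nnegrE.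
rewrite /source_weight y1.
apply: (@le_trans _ _ ((c * expR (- (enorm (x - y) ^+ 2 / 4)))%:E *
    (expR (- (lam * enorm y ^+ 2)) `^ p)%:E)%E); last first.
  apply: lee_pmul => //; rewrite ?lee_fin ?mulr_ge0 ?expR_ge0 ?powR_ge0//; first exact: ltW.
  by apply: ler_peMl; rewrite ?powR_ge0// -[leLHS](powRr0 (enorm y)) ler_powR.
rewrite -EFinM lee_fin /k -expRM -[leRHS]mulrA.
rewrite [leLHS](_ : _ = c * (expR (- n%:R) * expR (- (p * D / 2)) * e)); last by ring.
apply: ler_wpM2l; first exact: ltW.
rewrite /e -!expRD ler_expR.
have h1 : p * lam * enorm y ^+ 2 <= p * lam * ((1 + dl) * enorm x ^+ 2 + D).
  by apply: ler_wpM2l => //; rewrite mulr_ge0// ltW.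
have h2 : p * D * lam <= p * D * (1 / 2).
  by apply: ler_wpM2l => //; rewrite mulr_ge0// ltW.
have h3 : p * lam * ((1 + dl) * enorm x ^+ 2 + D) =
    lam * (p * (1 + dl)) * enorm x ^+ 2 + p * D * lam by ring.
rewrite pdl in h3; lra.
Qed.

End BesselOperator.

(** * The recursion for the constants *)

Section IterationCoefficients.
Context {R : realType}.

Lemma continuous_powRr (K : R) : 0 < K -> continuous (fun e : R => K `^ e).
Proof.
move=> K0 e; have -> : (fun e : R => K `^ e) = fun e => expR (e * ln K).
  by apply/funext => r; rewrite /powR gt_eqF.
apply: (@continuous_comp _ _ _ (fun r : R => r * ln K) expR); last exact: continuous_expR.
by apply: cvgMr_tmp; exact: cvg_id.
Qed.

Lemma cvg_powRr (K l : R) (e : nat -> R) : 0 < K -> e i @[i --> \oo] --> l ->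
  K `^ e i @[i --> \oo] --> K `^ l.
Proof.
by move=> K0 el; apply: (@cvg_comp _ _ _ e (fun r => K `^ r) _ _ _ el);
  exact: continuous_powRr.
Qed.

(* The solution of A_0 = A, A_(i+1) = K A_i^p. *)
Definition itercoef (p K A : R) (i : nat) : R :=
  K `^ ((1 - p ^+ i) / (1 - p)) * A `^ (p ^+ i).

Lemma itercoef_ge0 p K A i : 0 <= itercoef p K A i.
Proof. by rewrite mulr_ge0 ?powR_ge0. Qed.

Lemma itercoef0 p K A : 0 <= A -> itercoef p K A 0 = A.
Proof. by move=> A0; rewrite /itercoef expr0 subrr mul0r powRr0 mul1r powRr1. Qed.

Lemma itercoefS p K A i : p < 1 -> 0 < K ->
  itercoef p K A i.+1 = K * itercoef p K A i `^ p.
Proof.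
move=> p1 K0; have q0 : 1 - p != 0 by rewrite subr_eq0 gt_eqF.
rewrite /itercoef powRM ?powR_ge0// -!powRrM mulrA -exprSr; congr (_ * _).
rewrite -{2}(powRr1 (ltW K0)) -powRD; last by rewrite (gt_eqF K0) implybT.
by congr (_ `^ _); rewrite exprSr; field.
Qed.

Lemma cvg_expr0 (p : R) : 0 < p -> p < 1 -> p ^+ i @[i --> \oo] --> 0.
Proof. by move=> p0 p1; apply: cvg_expr; rewrite ger0_norm// ltW. Qed.

Lemma cvg_geometric_sum (p : R) : 0 < p -> p < 1 ->
  (1 - p ^+ i) / (1 - p) @[i --> \oo] --> 1 / (1 - p).
Proof.
move=> p0 p1; apply: cvgMr_tmp; rewrite -[X in _ --> X]subr0.
by apply: cvgB; [exact: cvg_cst|exact: cvg_expr0].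
Qed.

(** The exponent [p^i] of [A] tends to 0, so the initial constant is forgotten, while that of [K] is
    a partial geometric sum. *)
Lemma cvg_itercoef (p K A : R) : 0 < p -> p < 1 -> 0 < K -> 0 < A ->
  itercoef p K A i @[i --> \oo] --> K `^ (1 / (1 - p)).
Proof.
move=> p0 p1 K0 A0.
rewrite (_ : K `^ _ = K `^ (1 / (1 - p)) * A `^ 0); last by rewrite powRr0 mulr1.
apply: cvgM; apply: cvg_powRr => //; first exact: cvg_geometric_sum.
exact: cvg_expr0.
Qed.

End IterationCoefficients.

(** * Iteration *)

Section Iteration.
Context {R : realType}.
Local Notation leb := (@lebesgue_measure R).
Variables (n : nat) (p sigma T : R) (Lam : R -> R) (V : 'rV[R]_n -> R -> R).
Variables (u0 : 'rV[R]_n -> R) (m : 'rV[R]_n -> R -> R).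
Hypotheses (p_gt0 : 0 < p) (p_lt1 : p < 1) (T0 : 0 < T).
Hypothesis cLam : {within `[0, T], continuous Lam}.
Hypothesis Lam_gt0 : forall t, 0 <= t <= T -> 0 < Lam t.
Hypothesis V_ge0 : forall x t, 0 <= t <= T -> 0 <= V x t.
Hypothesis V_ge : forall x t, 1 <= enorm x -> 0 < t -> t <= T ->
  Lam t * enorm x `^ sigma <= V x t.
Hypothesis u0_ge0 : forall x, 0 <= u0 x.
Hypothesis m_ge0 : forall x t, 0 <= t <= T -> 0 <= m x t.
Hypothesis super : forall x t, 0 <= t <= T ->
  ((u0 x)%:E
   + \int[leb]_(tau in `[0%R, t]) besselOp (fun y => m y tau) x
   + \int[leb]_(tau in `[0%R, t])
       ((expR ((1 - p) * tau))%R%:E * besselOp (fun y => (V y tau * m y tau `^ p)%R) x)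
   <= (m x t)%:E)%E.

Let a := 1 / (1 - p).
Let q_gt0 : 0 < 1 - p. Proof. by rewrite subr_gt0. Qed.
Let a_gt0 : 0 < a. Proof. by rewrite divr_gt0. Qed.
Let aM : a * (1 - p) = 1. Proof. by rewrite /a divfK// gt_eqF. Qed.
Let a_gt1 : 1 < a. Proof. by rewrite /a div1r invf_gt1// gtrBl. Qed.
Let aS : a * p = a - 1. Proof. by move: aM; lra. Qed.

Local Notation J := (primitive Lam).
Local Notation weight := (source_weight p sigma).

Let linear_ge0 x tau : 0 <= tau <= T -> (0 <= besselOp (fun y => m y tau) x)%E.
Proof. by move=> h; apply: besselOp_ge0 => y; exact: m_ge0. Qed.

Let source_ge0 x tau : 0 <= tau <= T ->
  (0 <= (expR ((1 - p) * tau))%:E * besselOp (fun y => (V y tau * m y tau `^ p)%R) x)%E.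
Proof.
move=> h; rewrite mule_ge0 ?lee_fin ?expR_ge0//; apply: besselOp_ge0 => y.
by rewrite mulr_ge0 ?powR_ge0 ?V_ge0.
Qed.

(** The datum [u0] and the times before [s] contribute nonnegatively and are dropped; on [[s, t]]
    both integrands are replaced by the explicit minorants [g1] and [g2]. *)
Lemma supersolution_ge x s t (g1 g2 : R -> R) : 0 <= s -> s <= t -> t <= T ->
  (forall tau, s <= tau <= t -> 0 <= g1 tau /\
     ((g1 tau)%:E <= besselOp (fun y => m y tau) x)%E) ->
  (forall tau, s <= tau <= t -> 0 <= g2 tau /\
     ((g2 tau)%:E <= (expR ((1 - p) * tau))%:E *
        besselOp (fun y => (V y tau * m y tau `^ p)%R) x)%E) ->
  (\int[leb]_(tau in `[s, t]) (g1 tau)%:E + \int[leb]_(tau in `[s, t]) (g2 tau)%:E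
   <= (m x t)%:E)%E.
Proof.
move=> s0 st tT h1 h2.
have sub : `[s, t] `<=` `[0, t].
  by move=> r /=; rewrite !in_itv/= => /andP[sr ->]; rewrite (le_trans s0 sr).
have inT r : `[0, t]%classic r -> 0 <= r <= T.
  by rewrite /= in_itv/= => /andP[-> rt]; rewrite (le_trans rt tT).
apply: le_trans (super x t _); last by rewrite (le_trans s0 st) tT.
apply: leeD.
  apply: le_trans (leeDr _ _); last by rewrite lee_fin.
  apply: le_lower_integral => //.
  - by move=> r; rewrite /= in_itv/= => /h1[]; rewrite lee_fin.
  - by move=> r /inT; exact: linear_ge0.
  - by move=> r; rewrite /= in_itv/= => /h1[].
apply: le_lower_integral => //.
- by move=> r; rewrite /= in_itv/= => /h2[]; rewrite lee_fin.
- by move=> r /inT; exact: source_ge0.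
- by move=> r; rewrite /= in_itv/= => /h2[].
Qed.

Lemma supersolution_ge_init x t : 0 <= t <= T -> u0 x <= m x t.
Proof.
move=> tT; rewrite -lee_fin; apply: le_trans (super x t tT).
have inT r : `[0, t]%classic r -> 0 <= r <= T.
  by case/andP: tT => _ tT; rewrite /= in_itv/= => /andP[-> rt]; rewrite (le_trans rt tT).
rewrite -addeA leeDl// adde_ge0//; apply: integral_ge0 => r /inT.
  exact: linear_ge0.
exact: source_ge0.
Qed.

(** Here [z] is the time factor of the bound at [tau]; being constant in [y], it leaves the operator
    together with [A] and [Lam tau]. Where [|y| < 1] the weight is 0 and [V >= 0] suffices. *)
Lemma besselOp_source_ge (A z k : R) (w w' : 'rV[R]_n -> R) x tau : 0 < tau <= T ->
  0 <= A -> 0 <= z -> (forall y, 0 <= w y) ->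
  (forall y, A * w y * z <= m y tau) ->
  ((k * w' x)%:E <= besselOp (weight w) x)%E ->
  ((Lam tau * (A `^ p * z `^ p) * (k * w' x))%:E <=
     besselOp (fun y => (V y tau * m y tau `^ p)%R) x)%E.
Proof.
move=> /andP[t0 tT] A0 z0 w0 h hk.
have tT' : 0 <= tau <= T by rewrite ltW.
set c := Lam tau * (A `^ p * z `^ p).
have c0 : 0 <= c.
  by rewrite mulr_ge0 ?mulr_ge0 ?powR_ge0//; exact/ltW/Lam_gt0.
rewrite EFinM; apply: (@le_trans _ _ (c%:E * besselOp (weight w) x)%E).
  by apply: lee_wpmul2l => //; rewrite lee_fin.
rewrite -besselOpZ//; last exact: source_weight_ge0.
apply: le_besselOp => y; first by rewrite mulr_ge0 ?source_weight_ge0.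
rewrite /source_weight; case: ifPn => y1; last first.
  by rewrite mulr0 mulr_ge0 ?powR_ge0 ?V_ge0.
rewrite (_ : c * _ = (Lam tau * enorm y `^ sigma) * (A * w y * z) `^ p); last first.
  by rewrite !powRM ?mulr_ge0// /c; ring.
apply: ler_pM; rewrite ?powR_ge0//.
- by rewrite mulr_ge0 ?powR_ge0//; exact/ltW/Lam_gt0.
- exact: V_ge.
- by apply: ge0_ler_powR => //; rewrite ?nnegrE ?(ltW p_gt0) ?mulr_ge0 ?m_ge0.
Qed.

(** With [Theta = J - J s], the relation [a p = a - 1] turns [Lam (Theta^a)^p] into [1 - p] times
    the derivative of [Theta^a], so the time profile reproduces itself. The linear term is bounded
    below by 0 and [e^((1 - p) tau)] by 1. *)
Lemma iteration_step (s A k : R) (w w' : 'rV[R]_n -> R) : 0 < s -> 0 <= A -> 0 <= k ->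
  (forall y, 0 <= w y) -> (forall y, 0 <= w' y) ->
  (forall x, ((k * w' x)%:E <= besselOp (weight w) x)%E) ->
  (forall x t, s <= t <= T -> A * w x * (J t - J s) `^ a <= m x t) ->
  forall x t, s <= t <= T ->
    (k * (1 - p) * A `^ p) * w' x * (J t - J s) `^ a <= m x t.
Proof.
move=> s0 A0 k0 w0 w'0 hk h x t /andP[st tT].
have t0 : 0 <= t <= T by rewrite tT (le_trans (ltW s0) st).
have [ts|stn] := eqVneq s t.
  by rewrite ts subrr powR0 ?gt_eqF// mulr0 m_ge0.
have {stn}st' : s < t by rewrite lt_neqAle stn.
set C := _ * w' x.
have C0 : 0 <= C by rewrite mulr_ge0// mulr_ge0 ?powR_ge0// mulr_ge0// ltW.
pose g tau := a * (Lam tau * (J tau - J s) `^ (a - 1)).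
have inT tau : s <= tau <= t -> 0 < tau <= T.
  by move=> /andP[h1 h2]; rewrite (lt_le_trans s0 h1) (le_trans h2 tT).
have g0 tau : s <= tau <= t -> 0 <= g tau.
  move=> /inT/andP[h1 h2]; apply: mulr_ge0; first exact: ltW.
  by apply: mulr_ge0; [apply/ltW/Lam_gt0; rewrite ltW|exact: powR_ge0].
rewrite -lee_fin; apply: le_trans (supersolution_ge x s t (fun=> 0) (fun tau => C * g tau)
  (ltW s0) st tT _ _).
- rewrite integral0 add0e EFinM.
  rewrite -(integral_primitive_powR Lam T T0 cLam Lam_gt0 s t a (ltW s0) st' tT a_gt1).
  apply: lower_integralZ_in_le => // tau; rewrite /= in_itv/=; exact: g0.
- move=> tau /inT/andP[h1 h2]; split => //; apply: linear_ge0; by rewrite ltW.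
move=> tau tst; have /andP[h1 h2] := inT _ tst; have /andP[h3 h4] := tst.
split; first by rewrite mulr_ge0// g0.
have Jp : 0 <= J tau - J s.
  by rewrite subr_ge0; apply: (primitive_homo Lam T) => //; exact: ltW.
have hm y : A * w y * (J tau - J s) `^ a <= m y tau by apply: h; rewrite h3.
have H := besselOp_source_ge A ((J tau - J s) `^ a) k w w' x tau (inT _ tst) A0
  (powR_ge0 _ _) w0 hm (hk x).
apply: (@le_trans _ _ (1%:E * besselOp (fun y => (V y tau * m y tau `^ p)%R) x)%E); last first.
  apply: lee_wpmul2r.
    by apply: besselOp_ge0 => y; rewrite mulr_ge0 ?powR_ge0 ?V_ge0// ltW.
  rewrite lee_fin; apply: le_trans (expR_ge1Dx _); rewrite lerDl.
  by apply: mulr_ge0; exact: ltW.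
rewrite mul1e; apply: le_trans H; rewrite lee_fin -powRrM aS le_eqVlt; apply/orP; left; apply/eqP.
rewrite /C /g; set P := (J tau - J s) `^ _; set B := A `^ p.
transitivity ((a * (1 - p)) * (Lam tau * (B * P) * (k * w' x))); first by ring.
by rewrite aM mul1r.
Qed.

(** * Recovering the factor [e^t] with the linear term *)

Section Absorption.
Variables (s A k : R) (w w' : 'rV[R]_n -> R).
Hypotheses (s0 : 0 < s) (A0 : 0 <= A) (k0 : 0 <= k).
Hypotheses (w0 : forall y, 0 <= w y) (w'0 : forall y, 0 <= w' y).
Hypothesis source_w : forall x, ((k * w' x)%:E <= besselOp (weight w) x)%E.
Hypothesis linear_w' : forall x, ((w' x)%:E <= besselOp w' x)%E.
Hypothesis m_ge : forall x t, s <= t <= T ->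
  A * w x * (expR t * (J t - J s) `^ a) <= m x t.

Let Q := k * (1 - p) * A `^ p.
Let Q0 : 0 <= Q.
Proof. by rewrite mulr_ge0 ?powR_ge0// mulr_ge0// ltW. Qed.

(** If a fraction [th] of the target [Q w' E] is known, with [E] the time profile, the linear term
    returns [th al] and the source term all of [be], where [al + be = E t]. The gain [(1 - th) be]
    is quantified by [be >= (J t - J s)^a >= e^(-T) E t]. *)
Lemma absorption_step (th : R) : 0 <= th -> th <= 1 ->
  (forall x t, s <= t <= T -> th * Q * w' x * (expR t * (J t - J s) `^ a) <= m x t) ->
  forall x t, s <= t <= T ->
    (th + (1 - th) * expR (- T)) * Q * w' x * (expR t * (J t - J s) `^ a) <= m x t.
Proof.
move=> th0 th1 hth x t /andP[st tT].
have t0 : 0 <= t <= T by rewrite tT (le_trans (ltW s0) st).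
have [ts|stn] := eqVneq s t.
  by rewrite ts subrr powR0 ?gt_eqF// !mulr0 m_ge0.
have {stn}st' : s < t by rewrite lt_neqAle stn.
set C := Q * w' x.
have C0 : 0 <= C by rewrite mulr_ge0.
pose g tau := a * (Lam tau * (J tau - J s) `^ (a - 1)).
pose E tau := expR tau * (J tau - J s) `^ a.
have E0 tau : 0 <= E tau by rewrite mulr_ge0 ?expR_ge0 ?powR_ge0.
have inT tau : s <= tau <= t -> 0 < tau <= T.
  by move=> /andP[h1 h2]; rewrite (lt_le_trans s0 h1) (le_trans h2 tT).
have inT' tau : s <= tau <= t -> 0 <= tau <= T.
  by move=> /inT/andP[h1 h2]; rewrite ltW.
have g0 tau : s <= tau <= t -> 0 <= g tau.
  move=> /inT' h; apply: mulr_ge0; first exact: ltW.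
  by apply: mulr_ge0; [exact/ltW/Lam_gt0|exact: powR_ge0].
have eg0 tau : s <= tau <= t -> 0 <= expR tau * g tau.
  by move=> /g0 h; apply: mulr_ge0 => //; exact: expR_ge0.
have main : (\int[leb]_(tau in `[s, t]) (th * C * E tau)%:E +
    \int[leb]_(tau in `[s, t]) (C * (expR tau * g tau))%:E <= (m x t)%:E)%E.
  apply: supersolution_ge => //; first exact: ltW.
    move=> tau tst; have tQE : 0 <= th * Q * E tau by rewrite mulr_ge0// mulr_ge0.
    split; first by rewrite mulr_ge0// mulr_ge0.
    apply: (@le_trans _ _ ((th * Q * E tau)%:E * besselOp w' x)%E).
      rewrite (_ : th * C * E tau = (th * Q * E tau) * w' x); last by rewrite /C; ring.
      by rewrite EFinM; apply: lee_wpmul2l; [rewrite lee_fin|exact: linear_w'].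
    rewrite -besselOpZ//; apply: le_besselOp => y; first exact: mulr_ge0.
    have /andP[h1 h2] := tst; have := hth y tau; rewrite h1 (le_trans h2 tT) => /(_ isT).
    by apply: le_trans; rewrite /E le_eqVlt; apply/orP; left; apply/eqP; ring.
  move=> tau tst; have /andP[h1 h2] := tst.
  split; first by apply: mulr_ge0 => //; exact: eg0.
  have hm y : A * w y * E tau <= m y tau by apply: m_ge; rewrite h1 (le_trans h2 tT).
  have H := besselOp_source_ge A (E tau) k w w' x tau (inT _ tst) A0 (E0 tau) w0 hm
    (source_w x).
  have e0 : (0 <= (expR ((1 - p) * tau))%:E)%E by rewrite lee_fin expR_ge0.
  apply: le_trans (lee_wpmul2l e0 H).
  rewrite -EFinM lee_fin le_eqVlt; apply/orP; left; apply/eqP.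
  rewrite /E powRM ?expR_ge0 ?powR_ge0// -powRrM aS -expRM.
  have ee : expR tau = expR ((1 - p) * tau) * expR (tau * p).
    by rewrite -expRD; congr expR; ring.
  rewrite [in LHS]ee /C /g /Q; set P := (J tau - J s) `^ _; set B := A `^ p.
  set e1 := expR _; set e2 := expR _.
  transitivity ((a * (1 - p)) * (e1 * (Lam tau * (B * (e2 * P)) * (k * w' x)))); first by ring.
  by rewrite aM mul1r.
set al := (\int[leb]_(tau in `[s, t]) (E tau)%:E)%E.
set be := (\int[leb]_(tau in `[s, t]) (expR tau * g tau)%:E)%E.
have al0 : (0 <= al)%E by apply: integral_ge0 => tau _; rewrite lee_fin.
have be0 : (0 <= be)%E.
  by apply: integral_ge0 => tau; rewrite /= in_itv/= lee_fin; exact: eg0.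
have sum : (al + be = (E t)%:E)%E.
  exact: (integral_expR_primitive_powR_split Lam T T0 cLam Lam_gt0 s t a (ltW s0) st' tT a_gt1).
have be_ge : (((J t - J s) `^ a)%:E <= be)%E.
  rewrite -(integral_primitive_powR Lam T T0 cLam Lam_gt0 s t a (ltW s0) st' tT a_gt1).
  apply: le_lower_integral => // tau; rewrite /= in_itv/= => tst.
  rewrite lee_fin ler_peMl//; first exact: g0.
  by case/andP: (inT' _ tst) => h _; rewrite (le_trans _ (expR_ge1Dx _))// lerDl.
have L : ((th * C)%:E * al + C%:E * be <= (m x t)%:E)%E.
  apply: le_trans main; apply: leeD.
    by apply: lower_integralZ_in_le; [rewrite mulr_ge0|move=> tau _; rewrite lee_fin].
  by apply: lower_integralZ_in_le => // tau; rewrite /= in_itv/= => h; exact: eg0.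
clearbody al be.
move: al be al0 be0 sum be_ge L => [al| |] [be| |] // _ _.
rewrite -EFinD => -[sum]; rewrite lee_fin -!EFinM -EFinD lee_fin => be_ge L.
apply: le_trans L.
have eT : expR (- T) * E t <= (J t - J s) `^ a.
  rewrite /E mulrA -expRD ler_piMl ?powR_ge0// expR_le1; lra.
have -> : th * C * al + C * be = C * (th * E t + (1 - th) * be) by rewrite -sum; ring.
have -> : (th + (1 - th) * expR (- T)) * Q * w' x * (expR t * (J t - J s) `^ a) =
    C * (th * E t + (1 - th) * (expR (- T) * E t)) by rewrite /C /E; ring.
apply: ler_wpM2l => //; rewrite lerD2l; apply: ler_wpM2l; first by rewrite subr_ge0.
exact: le_trans be_ge.
Qed.

(** Starting from the fraction 0, where the bound is [m >= 0], each absorption multiplies the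
    missing fraction by [1 - e^(-T)]; in the limit nothing is missing. *)
Lemma iteration_step_expR x t : s <= t <= T ->
  Q * w' x * (expR t * (J t - J s) `^ a) <= m x t.
Proof.
move=> tst; set eta := expR (- T).
have eta0 : 0 < eta by rewrite expR_gt0.
have eta1 : eta <= 1 by rewrite expR_le1 oppr_le0 ltW.
have e01 : 0 <= 1 - eta <= 1 by rewrite subr_ge0 eta1 gerBl ltW.
have X0 i : 0 <= (1 - eta) ^+ i by case/andP: e01 => h _; rewrite exprn_ge0.
have X1 i : (1 - eta) ^+ i <= 1 by case/andP: e01 => h h'; rewrite exprn_ile1.
have H i : forall x t, s <= t <= T ->
    (1 - (1 - eta) ^+ i) * Q * w' x * (expR t * (J t - J s) `^ a) <= m x t.
  elim: i => [|i IH] y r rst.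
    rewrite expr0 subrr !mul0r m_ge0//; case/andP: rst => h ->.
    by rewrite (le_trans (ltW s0) h).
  have := absorption_step (1 - (1 - eta) ^+ i) _ _ IH y r rst.
  rewrite subr_ge0 X1 gerBl X0 => /(_ isT isT); apply: le_trans.
  rewrite exprSr -/eta le_eqVlt; apply/orP; left; apply/eqP; ring.
have cv : (1 - (1 - eta) ^+ i) * (Q * w' x * (expR t * (J t - J s) `^ a)) @[i --> \oo] -->
    (1 - 0) * (Q * w' x * (expR t * (J t - J s) `^ a)).
  apply: cvgMr_tmp; apply: cvgB; first exact: cvg_cst.
  by apply: cvg_expr; rewrite ger0_norm; lra.
rewrite subr0 mul1r in cv; apply: (cvgr_to_le cv); apply: nearW => i.
by have := H i x t tst; rewrite !mulrA.
Qed.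

End Absorption.

(** The weights [e^(-lam_i |x|^2)] with [lam_i = q^i / 2] tend to 1 at each [x], while the
    coefficients converge to [K^a > 0]: the limit is a bound uniform in space. *)
Lemma gaussian_iteration s : (1 <= n)%N -> 0 <= sigma -> continuous u0 ->
  (exists x, u0 x != 0) -> 0 < s -> s < T ->
  exists2 c : R, 0 < c & forall x t, s <= t <= T -> c * (J t - J s) `^ a <= m x t.
Proof.
move=> n1 sg0 cu0 u0n0 s0 sT.
have [c0 c0p Hc0] := besselOp_gauss_ge n u0 u0_ge0 cu0 u0n0.
have [k kp Hk] := besselOp_source_gauss_ge n p sigma n1 p_gt0 p_lt1 sg0.
pose q := (1 + p) / 2.
have q0 : 0 < q by rewrite divr_gt0// addr_gt0.
have q1 : q < 1 by rewrite /q ltr_pdivrMr// mul1r -[2]/(1 + 1) ltrD2l.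
pose w i (x : 'rV[R]_n) := expR (- (q ^+ i / 2 * enorm x ^+ 2)).
have w_ge0 i x : 0 <= w i x by exact: expR_ge0.
have ThT : 0 < (J T - J s) `^ a.
  by rewrite powR_gt0// subr_gt0 (primitive_mono Lam T)// ltW.
(* Normalised so that [A (J t - J s)^a <= s c0] up to time [T], which puts the initial Gaussian
   bound into the form of the iteration. *)
pose A := s * c0 / (J T - J s) `^ a.
have A_gt0 : 0 < A by rewrite divr_gt0// mulr_gt0.
pose K := k * (1 - p).
have K_gt0 : 0 < K by rewrite mulr_gt0.
(* First [m >= u0]; then the linear term, at least [besselOp u0 x] at each time, is integrated over
   [[0, t]] with [t >= s]. *)
have init x t : s <= t <= T -> s * c0 * w 0%N x <= m x t.
  move=> /andP[st tT]; have t0 : 0 <= t by rewrite (le_trans (ltW s0) st).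
  have cw : 0 <= c0 * w 0%N x by rewrite mulr_ge0// ltW.
  have inT tau : 0 <= tau <= t -> 0 <= tau <= T.
    by move=> /andP[-> h]; rewrite (le_trans h tT).
  have := supersolution_ge x 0 t (fun=> c0 * w 0%N x) (fun=> 0) (lexx 0) t0 tT.
  rewrite integral0 adde0 integral_cst; last exact: measurable_itv.
  rewrite [X in (_ * X)%E]lebesgue_measure_itv/= lte_fin (lt_le_trans s0 st).
  rewrite -EFinB -EFinM lee_fin subr0 => H.
  apply: (@le_trans _ _ (c0 * w 0%N x * t)); first by rewrite -mulrA mulrC ler_wpM2l.
  apply: H => tau /inT tT'; split => //; last exact: source_ge0.
  apply: (@le_trans _ _ (besselOp u0 x)).
    by have := Hc0 x; rewrite /w expr0.
  by apply: le_besselOp => // y; exact: supersolution_ge_init.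
have step i : forall x t, s <= t <= T ->
    itercoef p K A i * w i x * (J t - J s) `^ a <= m x t.
  elim: i => [|i IH] x t tst.
    rewrite itercoef0 ?(ltW A_gt0)//; apply: le_trans (init x t tst).
    rewrite (_ : A * _ * _ = s * c0 * w 0%N x * ((J t - J s) `^ a / (J T - J s) `^ a));
      last by rewrite /A; ring.
    case/andP: tst => st tT; apply: ler_piMr.
      by rewrite mulr_ge0// mulr_ge0 ?(ltW s0)// ltW.
    rewrite ler_pdivrMr// mul1r ge0_ler_powR ?nnegrE ?subr_ge0 ?(ltW a_gt0)//.
    - by apply: (primitive_homo Lam T) => //; exact: ltW.
    - by apply: (primitive_homo Lam T) => //; exact: ltW.
    - by rewrite lerD2r; apply: (primitive_homo Lam T) => //; rewrite (le_trans (ltW s0) st).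
  rewrite itercoefS// /K.
  apply: (iteration_step s (itercoef p K A i) k (w i) (w i.+1)) => //.
  - exact: itercoef_ge0.
  - exact: ltW.
  move=> y; have := Hk (q ^+ i / 2) _ y.
  rewrite /w (_ : (1 + p) / 2 * (q ^+ i / 2) = q ^+ i.+1 / 2); last first.
    by rewrite exprS /q; ring.
  apply; rewrite divr_ge0 ?exprn_ge0 ?(ltW q0)//= ler_pM2r// exprn_ile1// ltW//.
exists (K `^ a); first exact: powR_gt0.
move=> x t tst.
have cv : itercoef p K A i * w i x * (J t - J s) `^ a @[i --> \oo] -->
    K `^ a * 1 * (J t - J s) `^ a.
  apply: cvgMr_tmp; apply: cvgM; first exact: cvg_itercoef.
  rewrite -expR0; apply: (@cvg_comp _ _ _ (fun i => - (q ^+ i / 2 * enorm x ^+ 2)) expR);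
    last exact: continuous_expR.
  rewrite -oppr0 -(mul0r (enorm x ^+ 2)) -(mul0r 2^-1).
  by apply: cvgN; apply: cvgMr_tmp; apply: cvgMr_tmp; exact: cvg_expr0.
rewrite mulr1 in cv; apply: (cvgr_to_le cv); apply: nearW => i; exact: step.
Qed.

(** The exponents [d i] solve [d (i + 1) = sigma + p d i] from [d 0 = 0] and increase to
    [sigma / (1 - p)]. The hypothesis on [eps0] is applied at [p d i], which stays in its admissible
    range. *)
Lemma power_iteration s c eps0 : (1 <= n)%N -> Jplus n sigma -> 0 < s -> s < T ->
  0 < c -> 0 < eps0 ->
  (forall x t, s <= t <= T -> c * (J t - J s) `^ a <= m x t) ->
  (forall (x : 'rV[R]_n) d, 0 <= d -> d <= sigma * p / (1 - p) ->
    ((eps0 * enorm x `^ (sigma + d))%:E <=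
      besselOp (fun y => if (1 <= enorm y)%R then (enorm y `^ (sigma + d))%R else 0%R) x)%E) ->
  forall x, (eps0 * (1 - p)) `^ a * enorm x `^ (sigma * a) *
    (expR T * (J T - J s) `^ a) <= m x T.
Proof.
move=> n1 Jsg s0 sT c0 e0 Hc He x.
have sg0 : 0 <= sigma.
  by move: Jsg; rewrite /Jplus; case: ifP => // _ [->//|]; exact: le_trans.
have TT : s <= T <= T by rewrite (ltW sT) lexx.
have T00 : 0 <= T <= T by rewrite (ltW T0) lexx.
pose K := eps0 * (1 - p).
have K_gt0 : 0 < K by rewrite mulr_gt0.
pose d i := sigma * ((1 - p ^+ i) / (1 - p)).
have pi1 i : 0 <= p ^+ i <= 1.
  by rewrite exprn_ge0 ?exprn_ile1 ?(ltW p_gt0) ?(ltW p_lt1).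
have d_ge0 i : 0 <= d i.
  by rewrite mulr_ge0// divr_ge0 ?(ltW q_gt0)// subr_ge0; case/andP: (pi1 i).
have dS i : d i.+1 = sigma + d i * p.
  by rewrite /d exprSr; field; rewrite gt_eqF.
have d_le i : d i * p <= sigma * p / (1 - p).
  rewrite /d -mulrA -[leRHS]mulrA ler_wpM2l// mulrC; apply: ler_wpM2l; first exact: ltW.
  by rewrite -[leRHS]mul1r ler_wpM2r ?invr_ge0 ?(ltW q_gt0)// gerBl; case/andP: (pi1 i).
(* Only the exponents after the first step must lie in [Jplus]; for [n = 1] either all vanish or
   [d (i + 1) >= sigma >= 1]. *)
have dJ i : Jplus n (d i.+1).
  move: Jsg; rewrite /Jplus; case: ifP => // _ [h|h].
    by left; rewrite /d h mul0r.
  right; rewrite dS (le_trans h)// lerDl mulr_ge0 ?d_ge0 ?(ltW p_gt0)//.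
pose w i (y : 'rV[R]_n) := enorm y `^ d i.
have w_ge0 i y : 0 <= w i y by exact: powR_ge0.
(* The factor [e^(-T)] pays for the [e^t] that the iterated bound carries from the start. *)
pose A := c * expR (- T).
have A_gt0 : 0 < A by rewrite mulr_gt0 ?expR_gt0.
have step i : forall x t, s <= t <= T ->
    itercoef p K A i * w i x * (expR t * (J t - J s) `^ a) <= m x t.
  elim: i => [|i IH] y t tst.
    rewrite itercoef0 ?(ltW A_gt0)//; apply: le_trans (Hc y t tst).
    rewrite /w /d expr0 subrr mul0r mulr0 powRr0 mulr1 /A -mulrA ler_pM2l// mulrA -expRD.
    by rewrite ler_piMl ?powR_ge0// expR_le1; case/andP: tst => _; lra.
  rewrite itercoefS// /K.
  apply: (iteration_step_expR s (itercoef p K A i) eps0 (w i) (w i.+1)) => //.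
  - exact: itercoef_ge0.
  - exact: ltW.
  - move=> z; have := He z (d i * p) _ (d_le i); rewrite mulr_ge0 ?(ltW p_gt0)//.
    move=> /(_ isT); rewrite /w dS => /le_trans; apply; apply: le_besselOp => v.
      by case: ifP => // _; exact: powR_ge0.
    rewrite /source_weight; case: ifP => // v1.
    rewrite -powRrM -powRD//; apply/implyP => _.
    by rewrite gt_eqF// (lt_le_trans _ v1).
  - by move=> z; exact: besselOp_powR_ge.
have m0 : 0 <= m x T by exact: m_ge0.
(* The cases [sigma = 0] and [x = 0] are separated because [d |-> |x|^d] is continuous only for a
   positive base, [0^0] being 1. *)
have [sg00|sgn0] := eqVneq sigma 0.
  have cv : itercoef p K A i * (expR T * (J T - J s) `^ a) @[i --> \oo] -->
      K `^ a * (expR T * (J T - J s) `^ a).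
    by apply: cvgMr_tmp; exact: cvg_itercoef.
  rewrite sg00 mul0r powRr0 mulr1; apply: (cvgr_to_le cv); apply: nearW => i.
  by have := step i x T TT; rewrite /w /d sg00 mul0r powRr0 mulr1.
have [x0|x0] := eqVneq (enorm x) 0.
  by rewrite x0 powR0 ?mulr0 ?mul0r// mulf_neq0// gt_eqF.
have xp : 0 < enorm x by rewrite lt0r x0 enorm_ge0.
have cv : itercoef p K A i * w i x * (expR T * (J T - J s) `^ a) @[i --> \oo] -->
    K `^ a * enorm x `^ (sigma * a) * (expR T * (J T - J s) `^ a).
  apply: cvgMr_tmp; apply: cvgM; first exact: cvg_itercoef.
  by apply: cvg_powRr => //; apply: cvgMl_tmp; exact: cvg_geometric_sum.
by apply: (cvgr_to_le cv); apply: nearW => i; exact: step.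
Qed.

End Iteration.

(** * Choice of the horizon and vanishing starting time *)

Theorem mainTheorem2 (R : realType) (n : nat) (p : R) (tau0 : \bar R) (sigma : R)
    (Lambda : R -> R) (V : 'rV[R]_n -> R -> R) (u0 : 'rV[R]_n -> R) (eps0 : R)
    (u : 'rV[R]_n -> R -> R) :
  (1 <= n)%N -> 0 < p -> p < 1 -> (0 < tau0)%E -> Jplus n sigma ->
  {within [set t | inI tau0 t], continuous Lambda} ->
  (forall t, inI tau0 t -> 0 < Lambda t) ->
  {within [set z : 'rV[R]_n * R | inI tau0 z.2], continuous (fun z => V z.1 z.2)} ->
  (forall x t, inI tau0 t -> 0 <= V x t) ->
  (forall x t, 1 <= enorm x -> 0 < t -> (t%:E < tau0)%E ->
     Lambda t * enorm x `^ sigma <= V x t) ->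
  (forall x, 0 <= u0 x) -> continuous u0 -> (exists x, u0 x != 0) ->
  0 < eps0 ->
  (forall (x : 'rV[R]_n) (d : R), 0 <= d -> d <= sigma * p / (1 - p) ->
     ((eps0 * enorm x `^ (sigma + d))%:E <=
      intRn (fun y => if (1 <= enorm (x - y))%R
                      then bessel y * (enorm (x - y) `^ (sigma + d))%R%:E
                      else 0))%E) ->
  s_supersolution p V u0 tau0 u ->
  forall x t, inI tau0 t ->
    (eps0 * (1 - p) * enorm x `^ sigma
       * Rintegral lebesgue_measure `[0, t]%classic Lambda) `^ (1 / (1 - p))
    <= u x t.
Proof.
move=> n1 p0 p1 _ Jsg cLam Lam0 _ V0 Vlow u00 cu0 u0n0 e0 Heps [u_ge0 [_ sup]] x t [t0 tT].
rewrite -/(primitive Lambda t).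
have sg0 : 0 <= sigma.
  by move: Jsg; rewrite /Jplus; case: ifP => // _ [->//|]; exact: le_trans.
have q0 : 0 < 1 - p by rewrite subr_gt0.
have a0 : 0 < 1 / (1 - p) by rewrite divr_gt0.
move: t0; rewrite le_eqVlt => /predU1P[t00|t0].
  rewrite -t00 in tT *.
  by rewrite primitive0 mulr0 powR0 ?gt_eqF//; exact: u_ge0.
(* The horizon [T] of the iteration is the time [t] itself, so that only the compact interval
   [[0, t]] is involved. *)
have inT r : 0 <= r <= t -> inI tau0 r.
  by move=> /andP[r0 rt]; split => //; apply: le_lt_trans tT; rewrite lee_fin.
have cLam' : {within `[0, t], continuous Lambda}.
  by apply: continuous_subspaceW cLam => r /=; rewrite in_itv/=; exact: inT.
have Lam0' r : 0 <= r <= t -> 0 < Lambda r by move=> /inT; exact: Lam0.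
have V0' y r : 0 <= r <= t -> 0 <= V y r by move=> /inT; exact: V0.
have Vlow' y r : 1 <= enorm y -> 0 < r -> r <= t -> Lambda r * enorm y `^ sigma <= V y r.
  by move=> y1 r0 rt; apply: Vlow => //; apply: le_lt_trans tT; rewrite lee_fin.
pose m (y : 'rV[R]_n) r := expR r * u y r.
have m0 y r : 0 <= r <= t -> 0 <= m y r.
  by move=> /inT h; rewrite mulr_ge0 ?expR_ge0 ?u_ge0.
have sup' y r : 0 <= r <= t -> _ := fun h => sup y r (inT r h).
(* The reflection [z |-> y - z] brings the hypothesis on [eps0] into the form of a bound for
   [besselOp]. *)
have He (y : 'rV[R]_n) d : 0 <= d -> d <= sigma * p / (1 - p) ->
    ((eps0 * enorm y `^ (sigma + d))%:E <= besselOp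
      (fun z => if (1 <= enorm z)%R then (enorm z `^ (sigma + d))%R else 0%R) y)%E.
  move=> d0 d1; apply: (le_trans (Heps y d d0 d1)).
  apply: le_trans (intRn_reflect_le y _ _); last first.
    by move=> z; rewrite mule_ge0 ?bessel_ge0// lee_fin; case: ifP => // _; exact: powR_ge0.
  apply: le_intRn => z.
    by case: ifP => // _; rewrite mule_ge0 ?bessel_ge0// lee_fin powR_ge0.
  by rewrite opprB addrCA subrr addr0; case: ifP => // _; rewrite mule0.
(* The factor [e^t] gained in the iteration cancels the one in [m = e^t u]. The absolute value
   prepares the limit [s -> 0+], taken with [continuous_norm_powR]. *)
have key s : 0 < s -> s < t ->
    (eps0 * (1 - p)) `^ (1 / (1 - p)) * enorm x `^ (sigma * (1 / (1 - p))) *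
    `|primitive Lambda t - primitive Lambda s| `^ (1 / (1 - p)) <= u x t.
  move=> s0 st.
  have [c c0 Hc] := gaussian_iteration n p sigma t Lambda V u0 m p0 p1 t0 cLam' Lam0' V0'
    Vlow' u00 m0 sup' s n1 sg0 cu0 u0n0 s0 st.
  have := power_iteration n p sigma t Lambda V u0 m p0 p1 t0 cLam' Lam0' V0'
    Vlow' u00 m0 sup' s c eps0 n1 Jsg s0 st c0 e0 Hc He x.
  rewrite /m mulrCA ler_pM2l ?expR_gt0// ger0_norm// subr_ge0.
  by apply: (primitive_homo Lambda t) => //; exact: ltW.
have cJ : primitive Lambda s @[s --> 0^'+] --> primitive Lambda 0.
  by have [] := (continuous_within_itvP _ t0).1 (primitive_continuous Lambda t t0 cLam').
rewrite primitive0 in cJ.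
have Jt0 : 0 <= primitive Lambda t.
  rewrite -(primitive0 Lambda); apply: (primitive_homo Lambda t) => //; exact: ltW.
have cv : (eps0 * (1 - p)) `^ (1 / (1 - p)) * enorm x `^ (sigma * (1 / (1 - p))) *
    `|primitive Lambda t - primitive Lambda s| `^ (1 / (1 - p)) @[s --> 0^'+] -->
    (eps0 * (1 - p)) `^ (1 / (1 - p)) * enorm x `^ (sigma * (1 / (1 - p))) *
    `|primitive Lambda t - 0| `^ (1 / (1 - p)).
  apply: cvgMl_tmp.
  apply: (@cvg_comp _ _ _ (fun s => primitive Lambda t - primitive Lambda s)
    (fun y => `|y| `^ (1 / (1 - p)))); last exact: continuous_norm_powR.
  by apply: cvgB => //; exact: cvg_cst.
rewrite !powRM ?mulr_ge0 ?powR_ge0 ?(ltW e0) ?(ltW q0)//.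
rewrite -powRM ?(ltW e0) ?(ltW q0)// -powRrM.
rewrite -(ger0_norm Jt0) -[primitive _ _]subr0.
apply: (cvgr_to_le cv); near=> s; apply: key; near: s.
  exact: nbhs_right_gt.
exact: nbhs_right_lt.
Unshelve. all: by end_near. Qed.
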